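(* For any Lie groupoid $\mathcal{G}\rightrightarrows M$ one has an exact sequence $$0\longrightarrow H^1(\mathcal{G},\mathfrak{i})\xrightarrow{\ r\ }H^1_{\mathrm{def}}(\mathcal{G})\xrightarrow{\ \pi\ }\Gamma(\nu)^{\mathrm{inv}}\xrightarrow{\ K\ }H^2(\mathcal{G},\mathfrak{i})\xrightarrow{\ r\ }H^2_{\mathrm{def}}(\mathcal{G}).$$
   Context: Notation. For a Lie groupoid $\mathcal{G}\rightrightarrows M$, $s,t,m,u,i$ are the source, target, multiplication, unit and inversion; $gh$ is defined when $s(g)=t(h)$; $g:x\to y$ means $x=s(g)$, $y=t(g)$; $\mathcal{G}^{(k)}=\{(g_1,\dots,g_k): s(g_i)=t(g_{i+1})\}$; $\bar m(p,q)=pq^{-1}$ for $s(p)=s(q)$ (division map). For $g:x\to y$, $r_g$ and $l_g$ are the differentials of right translation $s^{-1}(y)\to s^{-1}(x)$ and left translation $t^{-1}(x)\to t^{-1}(y)$. The Lie algebroid $A$ has fibres $A_x=T_{1_x}s^{-1}(x)$ and anchor $\rho=dt|_A:A\to TM$. For $\alpha\in\Gamma(A)$ put $\overrightarrow{\alpha}(g)=r_g\alpha_{t(g)}$ and $\overleftarrow{\alpha}(g)=l_g(di(\alpha_{s(g)}))$. Deformation complex $(C^*_{\mathrm{def}}(\mathcal{G}),\delta)$ with cohomology $H^*_{\mathrm{def}}(\mathcal{G})$. For $k\ge 1$, $C^k_{\mathrm{def}}(\mathcal{G})$ consists of smooth maps $c:\mathcal{G}^{(k)}\to T\mathcal{G}$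 with $c(g_1,\dots,g_k)\in T_{g_1}\mathcal{G}$ such that $ds(c(g_1,\dots,g_k))=:s_c(g_2,\dots,g_k)$ does not depend on $g_1$; and $$(\delta c)(g_1,\dots,g_{k+1})=-d\bar m\big(c(g_1g_2,g_3,\dots,g_{k+1}),c(g_2,\dots,g_{k+1})\big)+\sum_{i=2}^k(-1)^ic(g_1,\dots,g_ig_{i+1},\dots,g_{k+1})+(-1)^{k+1}c(g_1,\dots,g_k).$$ $C^0_{\mathrm{def}}(\mathcal{G})=\Gamma(A)$ and $\delta(\alpha)=\overrightarrow{\alpha}+\overleftarrow{\alpha}$. Isotropy (no regularity assumed). $\mathfrak{i}_x=\ker(\rho_x)$, the Lie algebra of the isotropy group at $x$; $g:x\to y$ acts $\mathfrak{i}_x\to\mathfrak{i}_y$ by the differential of conjugation by $g$. $C^k(\mathcal{G},\mathfrak{i})$ is the space of maps $u$ with $u(g_1,\dots,g_k)\in\mathfrak{i}_{t(g_1)}$ that are smooth as $A$-valued maps on $\mathcal{G}^{(k)}$ (for $k=0$: $\ker(\rho:\Gamma(A)\to\mathfrak{X}(M))$), with $(\delta u)(g_1,\dots,g_{k+1})=g_1\cdot u(g_2,\dots,g_{k+1})+\sum_{i=1}^k(-1)^iu(\dots,g_ig_{i+1},\dots)+(-1)^{k+1}u(g_1,\dots,g_k)$; its cohomology is $H^*(\mathcal{G},\mathfrak{i})$. The map $r$ in cohomology (degrees $1,2$) is induced by the injection $u\mapsto c_u$, $c_u(g_1,\dots,g_k)=r_{g_1}(u(g_1,\dots,g_k))$,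 whose image consists of the deformation cochains with values in $\ker(ds)\cap\ker(dt)$. Normal invariants. $\Gamma(\nu):=\mathfrak{X}(M)/\rho(\Gamma(A))$; $[V]\in\Gamma(\nu)$ is invariant if some $X\in\mathfrak{X}(\mathcal{G})$ is both $s$- and $t$-projectable to $V$ (an $(s,t)$-lift of $V$); $\Gamma(\nu)^{\mathrm{inv}}$ is the space of invariant elements. Cocycles in $C^1_{\mathrm{def}}(\mathcal{G})$ are the multiplicative vector fields on $\mathcal{G}$ (those that are groupoid morphisms $\mathcal{G}\to T\mathcal{G}$), which are $s$- and $t$-projectable to a base field $V$; $\pi$ sends $[X]$ to $[V]$. The map $K$ sends $[V]$ to the class in $H^2(\mathcal{G},\mathfrak{i})$ of the unique cocycle $v\in C^2(\mathcal{G},\mathfrak{i})$ with $c_v=\delta(X)$, for any $(s,t)$-lift $X$ of $V$ (independent of choices). *)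

(* Defs.v *)
(* Lie groupoids over an abstract [R : realType], on top of MathComp-Analysis. *)
From HB Require Import structures.
From mathcomp Require Import all_boot all_order all_algebra.
From mathcomp Require Import all_classical all_reals.
From mathcomp Require Import topology normedtype landau derive.

Set Implicit Arguments.
Unset Strict Implicit.
Unset Printing Implicit Defensive.

Import Order.TTheory GRing.Theory Num.Theory numFieldNormedType.Exports.

Local Open Scope classical_set_scope.
Local Open Scope ring_scope.

(** * Calculus on open subsets of normed spaces *)

(* [f] is C^(k+1) on [U] iff it is differentiable on [U] and
   (x, v) |-> Df(x)v is C^k on U x E.  In finite dimension (the only case used
   below) this is the usual notion. *)
Fixpoint Ck (R : realType) (k : nat) (E F : normedModType R) (U : set E)
    (f : E -> F) {struct k} : Prop :=
  match k with
  | 0 => forall x, U x -> {for x, continuous f}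
  | k'.+1 => (forall x, U x -> differentiable f x) /\
      @Ck R k' (E * E)%type F [set p | U p.1] (fun p => 'd f (p.1) p.2)
  end.

Definition Cinfty (R : realType) (E F : normedModType R) (U : set E)
  (f : E -> F) := forall k, Ck k U f.

Section CkTheory.
Variable R : realType.
Implicit Types (E F G : normedModType R) (k : nat).

Lemma diff_near E F (f g : E -> F) x : (\forall y \near x, f y = g y) ->
  differentiable f x -> differentiable g x /\ 'd g x = 'd f x :> (E -> F).
Proof.
move=> fg df; have dfc : continuous ('d f x) by exact: diff_continuous.
have gE : g \o shift x = cst (g x) + 'd f x +o_ 0 id.
  apply/eqaddoP => e e0; have /diff_locally /eqaddoP /(_ e e0) := df.
  have fgx : f x = g x by exact: nbhs_singleton fg.
  apply: filter_app; move: fg; rewrite (near_shift 0) subr0.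
  apply: filterS => h /= fgh dfh.
  by move: dfh; rewrite /= !fctE /= fgh fgx.
by have dgE := diff_unique dfc gE; split => //; apply/diff_locallyP; rewrite dgE.
Qed.

Lemma Ck_eq k E F (U : set E) (f g : E -> F) : open U ->
  (forall x, U x -> f x = g x) -> Ck k U f -> Ck k U g.
Proof.
have near_fg E' F' (V : set E') (f' g' : E' -> F') x : open V ->
  (forall x, V x -> f' x = g' x) -> V x -> \forall y \near x, f' y = g' y.
  move=> oV fg Vx; have : nbhs x V by exact: open_nbhs_nbhs.
  exact: filterS.
elim: k E F U f g => [|k IH] E F U f g oU fg /=.
  move=> cf x Ux; rewrite /prop_for /continuous_at -(fg x Ux).
  by apply: cvg_trans (cf x Ux); apply: near_eq_cvg; exact: (near_fg _ _ U).
move=> [df Cf]; split=> [x Ux|].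
  by have [] := diff_near (near_fg _ _ _ _ _ x oU fg Ux) (df x Ux).
apply: IH Cf; first by apply: open_comp => // p _; exact: cvg_fst.
move=> p Up.
by have [_ ->] := diff_near (near_fg _ _ _ _ _ _ oU fg Up) (df _ Up).
Qed.

Lemma Ck_sub k E F (U V : set E) (f : E -> F) : U `<=` V ->
  Ck k V f -> Ck k U f.
Proof.
elim: k E F U V f => [|k IH] E F U V f UV /=; first by move=> cf x /UV/cf.
move=> [df Cf]; split=> [x /UV/df //|]; apply: IH Cf => p; exact: UV.
Qed.

Lemma CkS k E F (U : set E) (f : E -> F) : Ck k.+1 U f -> Ck k U f.
Proof.
elim: k E F U f => [|k IH] E F U f.
  by move=> /= [df _] x Ux; apply: differentiable_continuous; exact: df.
by move=> /= [df Cf]; split => //; exact: IH.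
Qed.

Lemma Ck_lin k E F (U : set E) (f : {linear E -> F}) :
  continuous f -> Ck k U f.
Proof.
elim: k E F U f => [|k IH] E F U f cf /=; first by move=> x _; exact: cf.
split=> [x _|]; first exact: linear_differentiable.
have -> : (fun p : E * E => 'd f (p.1) p.2) = (f \o snd).
  by apply/funext => p /=; rewrite diff_lin.
apply: (IH _ _ _ (f \o snd)) => /= p.
by apply: continuous_comp; [exact: cvg_snd|exact: cf].
Qed.

Lemma Ck_cst k E F (U : set E) (a : F) : Ck k U (cst a).
Proof.
case: k => [|k] /=; first by move=> x _; exact: cst_continuous.
split=> [x _|]; first exact: differentiable_cst.
have -> : (fun p : E * E => 'd (cst a : E -> F) (p.1) p.2) = (\0 : {linear _ -> _}).
  by apply/funext => p /=; rewrite diff_cst.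
by apply: Ck_lin; exact: cst_continuous.
Qed.

Lemma Ck_pair k E F G (U : set E) (f : E -> F) (g : E -> G) : open U ->
  Ck k U f -> Ck k U g -> Ck k U (fun x => (f x, g x)).
Proof.
elim: k E F G U f g => [|k IH] E F G U f g oU /=.
  move=> cf cg x Ux; exact: (cvg_pair (cf x Ux) (cg x Ux)).
move=> [df Cf] [dg Cg]; split=> [x Ux|].
  by apply: differentiable_pair; [exact: df|exact: dg].
have oU' : open [set p : E * E | U p.1].
  by apply: open_comp => // p _; exact: cvg_fst.
apply: (@Ck_eq _ _ _ _ (fun p : E * E => ('d f (p.1) p.2, 'd g (p.1) p.2))) => //.
  move=> p /= Up.
  by rewrite (diff_pair (df _ Up) (dg _ Up)).
exact: IH.
Qed.

Lemma Ck_comp k E F G (U : set E) (V : set F) (f : E -> F) (g : F -> G) :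
  open U -> open V -> (forall x, U x -> V (f x)) ->
  Ck k U f -> Ck k V g -> Ck k U (g \o f).
Proof.
elim: k E F G U V f g => [|k IH] E F G U V f g oU oV UV.
  move=> cf cg x Ux; apply: continuous_comp; first exact: cf.
  by apply: cg; exact: UV.
move=> Cf [dg Cg]; have [df Cdf] := Cf; split=> [x Ux|].
  by apply: differentiable_comp; [exact: df|apply: dg; exact: UV].
have oU' : open [set p : E * E | U p.1].
  by apply: open_comp => // p _; exact: cvg_fst.
have oV' : open [set p : F * F | V p.1].
  by apply: open_comp => // p _; exact: cvg_fst.
apply: (@Ck_eq _ _ _ _
    ((fun q : F * F => 'd g (q.1) q.2) \o (fun p : E * E => (f p.1, 'd f (p.1) p.2)))) => //.
  move=> p /= Up; rewrite (diff_comp (df _ Up)) //; apply: dg; exact: UV.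
apply: (IH _ _ _ _ [set q | V q.1]) => //; first by move=> p /=; exact: UV.
apply: Ck_pair => //.
apply: (IH _ _ _ _ U fst f) => //; last exact: CkS.
have cf : continuous (fst : E * E -> E) by move=> p; exact: cvg_fst.
exact: (@Ck_lin k (E * E)%type E _ fst cf).
Qed.

Lemma Ck_linear k E F (U : set E) (a : R) (f g : E -> F) : open U ->
  Ck k U f -> Ck k U g -> Ck k U (fun x => a *: f x + g x).
Proof.
move=> oU Cf Cg.
have lh : linear (fun p : F * F => a *: p.1 + p.2).
  by move=> b x y /=; rewrite !scalerDr !scalerA mulrC addrACA.
pose lhM := GRing.isLinear.Build _ _ _ _ _ lh.
pose h : {linear _ -> _} := HB.pack (fun p : F * F => a *: p.1 + p.2) lhM.
apply: (@Ck_comp k _ _ _ U setT (fun x => (f x, g x)) h) => //.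
- exact: openT.
- exact: Ck_pair.
- apply: Ck_lin => p /=; apply: (@cvgD _ F).
    by apply: (@cvgZr _ F); exact: cvg_fst.
  exact: cvg_snd.
Qed.

End CkTheory.

(** * Manifolds, smooth maps, differentials *)

(* Bare chart data: every point [p] comes with a preferred chart
   [chart p : cdom p -> model] around it, with inverse [chartV p].
   Charts are total functions, meaningful on [cdom p] only. *)
Record charted (R : realType) := Charted {
  pt : Type;
  model : normedModType R;
  cdom : pt -> set pt;
  chart : pt -> pt -> model;
  chartV : pt -> model -> pt }.

Arguments chart {R} c _ _.
Arguments chartV {R} c _ _.
Arguments cdom {R} c _ _.

(* A smooth manifold of dimension [n]: the preferred charts form a smooth
   atlas of a topological space.  Separation and countability are imposed
   separately, where they are wanted. *)
Record manifold (R : realType) (n : nat) := Manifold {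
  mpt :> topologicalType;
  mcdom : mpt -> set mpt;
  mchart : mpt -> mpt -> 'rV[R]_n;
  mchartV : mpt -> 'rV[R]_n -> mpt;
  mcdom_open : forall p, open (mcdom p);
  mcdom_center : forall p, mcdom p p;
  mchart_open : forall p, open (mchart p @` mcdom p);
  mchartK : forall p q, mcdom p q -> mchartV p (mchart p q) = q;
  mchart_cont : forall p q, mcdom p q -> {for q, continuous (mchart p)};
  mchartV_cont : forall p e, (mchart p @` mcdom p) e ->
    {for e, continuous (mchartV p)};
  mchart_smooth : forall p q,
    Cinfty (mchart p @` (mcdom p `&` mcdom q)) (mchart q \o mchartV p) }.

Definition charted_of (R : realType) (n : nat) (X : manifold R n) : charted R :=
  @Charted R X 'rV[R]_n (@mcdom R n X) (@mchart R n X) (@mchartV R n X).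
Coercion charted_of : manifold >-> charted.

Section Geometry.
Variable R : realType.
Implicit Types X Y Z : charted R.

(* The tangent space at [p] is the model space, a vector being given by its
   components in the preferred chart at [p]; [TM X] is the tangent bundle with
   its usual charts (x, v) |-> (phi x, D phi v). *)
Definition TM X : charted R :=
  @Charted R (pt X * model X)%type (model X * model X)%type
    (fun a => [set b | cdom X a.1 b.1])
    (fun a b => (chart X a.1 b.1,
       'd (chart X a.1 \o chartV X b.1) (chart X b.1 b.1) b.2))
    (fun a e => (chartV X a.1 e.1,
       'd (chart X (chartV X a.1 e.1) \o chartV X a.1) (e.1) e.2)).

Definition prodc X Y : charted R :=
  @Charted R (pt X * pt Y)%type (model X * model Y)%type
    (fun a => [set b | cdom X a.1 b.1 /\ cdom Y a.2 b.2])
    (fun a b => (chart X a.1 b.1, chart Y a.2 b.2))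
    (fun a e => (chartV X a.1 e.1, chartV Y a.2 e.2)).

(* the k-fold power of a manifold, with model space (R^n)^k *)
Definition powc (k n : nat) (X : manifold R n) : charted R :=
  @Charted R ('I_k -> X) 'M[R]_(k, n)
    (fun a => [set b | forall i, cdom X (a i) (b i)])
    (fun a b => \matrix_(i < k) chart X (a i) (b i))
    (fun a e => fun i => chartV X (a i) (row i e)).

(* [F], read in the preferred charts at [p] and [f p], is a smooth extension,
   to a neighbourhood of [p], of the restriction of [f] to [S]. *)
Definition local_ext X Y (S : set (pt X)) (f : pt X -> pt Y) (p : pt X)
    (F : model X -> model Y) : Prop :=
  exists U : set (model X),
    [/\ open U, U (chart X p p), Cinfty U F &
     forall q, S q -> cdom X p q -> U (chart X p q) ->
       cdom Y (f p) (f q) /\ chart Y (f p) (f q) = F (chart X p q)].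

(* Smoothness of the restriction of [f] to a subset: local extendability.
   For embedded submanifolds [S], such as all those used below, this is
   smoothness for the submanifold structure. *)
Definition smooth_on X Y (S : set (pt X)) (f : pt X -> pt Y) : Prop :=
  forall p, S p -> exists F, @local_ext X Y S f p F.

Definition smooth X Y (f : pt X -> pt Y) : Prop := @smooth_on X Y setT f.

(* the differential of a map at [p] *)
Definition tmap X Y (f : pt X -> pt Y) (p : pt X) (v : model X) : model Y :=
  'd (chart Y (f p) \o f \o chartV X p) (chart X p p) v.

(* The differential at [p] of the restriction of [f] to the submanifold [S],
   computed with some local smooth extension of it; on vectors tangent to [S]
   the result does not depend on the extension. *)
Definition tmap_on X Y (S : set (pt X)) (f : pt X -> pt Y) (p : pt X)
    (v : model X) : model Y :=
  'd (xget (fun=> 0) [set F | @local_ext X Y S f p F]) (chart X p p) v.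

Definition submersion X Y (f : pt X -> pt Y) : Prop :=
  smooth f /\ forall p w, exists v, tmap f p v = w.

(* smooth sections of the pullback of TY along b, over S *)
Definition smooth_along X Y (S : set (pt X)) (b : pt X -> pt Y)
    (c : pt X -> model Y) : Prop :=
  @smooth_on X (TM Y) S (fun p => (b p, c p)).

Definition vector_field X (V : pt X -> model X) : Prop :=
  smooth_along setT id V.

Lemma smooth_comp X Y Z (S : set (pt X)) (T : set (pt Y)) (f : pt X -> pt Y)
    (g : pt Y -> pt Z) : (forall p, cdom X p p) -> (forall p, S p -> T (f p)) ->
  smooth_on S f -> smooth_on T g -> smooth_on S (g \o f).
Proof.
move=> Xp ST sf sg p Sp.
have [F [U [oU Up CF FE]]] := sf p Sp.
have [F' [U' [oU' Up' CF' FE']]] := sg (f p) (ST p Sp).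
have oUU' : open (U `&` F @^-1` U').
  rewrite openE => x [Ux U'x]; apply: filterI; first exact: open_nbhs_nbhs.
  by apply: (CF 0%N x Ux); exact: open_nbhs_nbhs.
exists (F' \o F), (U `&` F @^-1` U'); split=> //.
- by split=> //=; have [_ <-] := FE p Sp (Xp p) Up.
- move=> k; apply: (@Ck_comp _ k _ _ _ _ U') => //; first by move=> x [].
  by apply: (Ck_sub _ (CF k)) => x [].
- move=> q Sq pq [Uq U'q]; have [fpq fE] := FE q Sq pq Uq.
  have [gpq gE] := FE' (f q) (ST q Sq) fpq (eq_ind_r U' U'q fE).
  by split=> //=; rewrite gE fE.
Qed.

Lemma smooth_along0 X Y (S : set (pt X)) (b : pt X -> pt Y) :
  smooth_on S b -> smooth_along S b (fun=> 0).
Proof.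
move=> sb p Sp; have [F [U [oU Up CF FE]]] := sb p Sp.
exists (fun e => (F e, 0)), U; split=> //.
  by move=> k; apply: Ck_pair => //; exact: Ck_cst.
move=> q Sq pq Uq; have [bpq bE] := FE q Sq pq Uq.
by split=> //=; rewrite bE linear0.
Qed.

Lemma smooth_along_lin X Y (S : set (pt X)) (b : pt X -> pt Y) (a : R)
    (c d : pt X -> model Y) : smooth_along S b c -> smooth_along S b d ->
  smooth_along S b (fun p => a *: c p + d p).
Proof.
move=> sc sd p Sp.
have [F [U [oU Up CF FE]]] := sc p Sp.
have [F' [U' [oU' Up' CF' FE']]] := sd p Sp.
have oUU' : open (U `&` U') by exact: openI.
exists (fun e => ((F e).1, a *: (F e).2 + (F' e).2)), (U `&` U'); split=> //.
  move=> k.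
  have CFk : Ck k (U `&` U') F by apply: (Ck_sub _ (CF k)) => x [].
  have CFk' : Ck k (U `&` U') F' by apply: (Ck_sub _ (CF' k)) => x [].
  have c1 : Ck k [set: model (TM Y)] (fst : model Y * model Y -> model Y).
    have cf : continuous (fst : model Y * model Y -> model Y).
      by move=> z; exact: cvg_fst.
    exact: (@Ck_lin _ k (model Y * model Y)%type (model Y) _ fst cf).
  have c2 : Ck k [set: model (TM Y)] (snd : model Y * model Y -> model Y).
    have cf : continuous (snd : model Y * model Y -> model Y).
      by move=> z; exact: cvg_snd.
    exact: (@Ck_lin _ k (model Y * model Y)%type (model Y) _ snd cf).
  apply: Ck_pair => //; last apply: Ck_linear => //.
  - by apply: (Ck_comp _ _ _ CFk c1) => //; exact: openT.
  - by apply: (Ck_comp _ _ _ CFk c2) => //; exact: openT.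
  - by apply: (Ck_comp _ _ _ CFk' c2) => //; exact: openT.
move=> q Sq pq [Uq U'q].
have [/= bpq bE] := FE q Sq pq Uq; have [/= _ bE'] := FE' q Sq pq U'q.
by split=> //=; rewrite -bE -bE' /= linearP.
Qed.

Lemma smooth_id X : smooth (id : pt X -> pt X).
Proof.
move=> p _; exists id, setT; split=> //; first exact: openT.
by move=> k; apply: (@Ck_lin _ k (model X) _ _ idfun) => x.
Qed.

Lemma smooth_sub X Y (S T : set (pt X)) (f : pt X -> pt Y) :
  S `<=` T -> smooth_on T f -> smooth_on S f.
Proof.
move=> ST sf p /ST/sf[F [U [oU Up CF FE]]]; exists F, U; split=> // q /ST.
exact: FE.
Qed.

Lemma smooth_coord k n (X : manifold R n) (i : 'I_k) :
  @smooth (powc k X) X (fun a => a i).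
Proof.
have cr : continuous (row i : 'M[R]_(k, n) -> 'rV[R]_n).
  move=> /= A s /= /nbhs_ballP[e e0 es]; apply/nbhs_ballP; exists e => //= B AB.
  apply: es; split=> // j l; rewrite !mxE; exact: AB.2.
move=> a _; exists (row i), setT; split=> //; first exact: openT.
  by move=> l; exact: Ck_lin.
by move=> b _ ab _; split; [exact: ab|rewrite /= rowK].
Qed.

Fact tmap_linear X Y (f : pt X -> pt Y) p a v w :
  tmap f p (a *: v + w) = a *: tmap f p v + tmap f p w.
Proof. exact: linearP. Qed.

Fact tmap_on_linear X Y S (f : pt X -> pt Y) p a v w :
  tmap_on S f p (a *: v + w) = a *: tmap_on S f p v + tmap_on S f p w.
Proof. exact: linearP. Qed.

End Geometry.

(** * Subspaces and subquotients *)

Record subspace (R : realType) (E : lmodType R) := Subspace {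
  subset_of :> E -> Prop;
  subspace0 : subset_of 0;
  subspace_lin : forall a u v,
    subset_of u -> subset_of v -> subset_of (a *: u + v) }.

(* The vector space of the cosets z + B with z in Z.  (When B is contained in
   Z, as for the cocycles and coboundaries of a complex, this is Z / B.) *)
Record subquot (R : realType) (E : lmodType R) (Z B : subspace E) := Subquot {
  coset : set E;
  cosetP : exists2 z, Z z & coset = [set x | B (x - z)] }.

Section Subquotient.
Variables (R : realType) (E : lmodType R) (Z B : subspace E).
Local Notation Q := (subquot Z B).

Lemma subspaceD (W : subspace E) u v : W u -> W v -> W (u + v).
Proof. by move=> Wu Wv; rewrite -[u]scale1r; exact: subspace_lin. Qed.

Lemma subspaceZ (W : subspace E) a u : W u -> W (a *: u).
Proof.
by move=> Wu; rewrite -[_ *: _]addr0; apply: subspace_lin => //; exact: subspace0.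
Qed.

Lemma subspaceN (W : subspace E) u : W u -> W (- u).
Proof. by rewrite -scaleN1r; exact: subspaceZ. Qed.

Definition sq_mk z (Zz : Z z) : Q := Subquot (ex_intro2 _ _ z Zz erefl).

Lemma sq_eq (p q : Q) : coset p = coset q -> p = q.
Proof.
by case: p q => [s sP] [t tP] /= st; subst t; congr Subquot; exact: Prop_irrelevance.
Qed.

Lemma sq_mkE z w (Zz : Z z) (Zw : Z w) : B (z - w) -> sq_mk Zz = sq_mk Zw.
Proof.
move=> Bzw; apply: sq_eq; apply/seteqP; split=> x /= Bx.
  by rewrite -(subrKA z); exact: subspaceD.
rewrite -(subrKA w); apply: subspaceD => //.
by rewrite -opprB; exact: subspaceN.
Qed.

Definition sq_rep (q : Q) : E := s2val (cid2 (cosetP q)).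

Lemma sq_repP (q : Q) : Z (sq_rep q).
Proof. exact: s2valP (cid2 (cosetP q)). Qed.

Lemma sq_repK (q : Q) : sq_mk (sq_repP q) = q.
Proof. by apply: sq_eq; rewrite /= -(s2valP' (cid2 (cosetP q))). Qed.

Lemma sq_mkK z (Zz : Z z) : B (sq_rep (sq_mk Zz) - z).
Proof.
have := congr1 (@coset _ _ _ _) (sq_repK (sq_mk Zz)).
move=> /= /seteqP[+ _] => /(_ (sq_rep (sq_mk Zz))); apply => /=.
by rewrite subrr; exact: subspace0.
Qed.

Definition sq_zero : Q := sq_mk (subspace0 Z).
Definition sq_add (p q : Q) : Q := sq_mk (subspaceD (sq_repP p) (sq_repP q)).
Definition sq_opp (p : Q) : Q := sq_mk (subspaceN (sq_repP p)).
Definition sq_scale (a : R) (p : Q) : Q := sq_mk (subspaceZ a (sq_repP p)).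

Lemma sq_addE z w (Zz : Z z) (Zw : Z w) :
  sq_add (sq_mk Zz) (sq_mk Zw) = sq_mk (subspaceD Zz Zw).
Proof.
apply: sq_mkE; rewrite opprD addrACA; apply: subspaceD; exact: sq_mkK.
Qed.

Lemma sq_scaleE a z (Zz : Z z) : sq_scale a (sq_mk Zz) = sq_mk (subspaceZ a Zz).
Proof. by apply: sq_mkE; rewrite -scalerBr; apply: subspaceZ; exact: sq_mkK. Qed.

Lemma sq_mk_irr z w (Zz : Z z) (Zw : Z w) : z = w -> sq_mk Zz = sq_mk Zw.
Proof.
by move=> zw; apply: sq_mkE; rewrite zw subrr; exact: subspace0.
Qed.

Fact sq_addA : associative sq_add.
Proof.
move=> p q r; rewrite -(sq_repK p) -(sq_repK q) -(sq_repK r) !sq_addE.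
by apply: sq_mk_irr; rewrite addrA.
Qed.

Fact sq_addC : commutative sq_add.
Proof. by move=> p q; apply: sq_mk_irr; rewrite addrC. Qed.

Fact sq_add0 : left_id sq_zero sq_add.
Proof.
by move=> p; rewrite -(sq_repK p) sq_addE; apply: sq_mk_irr; rewrite add0r.
Qed.

Fact sq_addN : left_inverse sq_zero sq_opp sq_add.
Proof.
by move=> p; rewrite -{2}(sq_repK p) sq_addE; apply: sq_mk_irr; rewrite addNr.
Qed.

HB.instance Definition _ := gen_eqMixin Q.
HB.instance Definition _ := gen_choiceMixin Q.
HB.instance Definition _ :=
  GRing.isZmodule.Build Q sq_addA sq_addC sq_add0 sq_addN.

Fact sq_scaleA a b (p : Q) : sq_scale a (sq_scale b p) = sq_scale (a * b) p.
Proof.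
by rewrite -(sq_repK p) !sq_scaleE; apply: sq_mk_irr; rewrite scalerA.
Qed.

Fact sq_scale1 : left_id 1 sq_scale.
Proof.
by move=> p; rewrite -(sq_repK p) sq_scaleE; apply: sq_mk_irr; rewrite scale1r.
Qed.

Fact sq_scaleDr : right_distributive sq_scale +%R.
Proof.
move=> a p q; rewrite -(sq_repK p) -(sq_repK q) -![_ + _]/(sq_add _ _).
by rewrite !(sq_addE, sq_scaleE); apply: sq_mk_irr; rewrite scalerDr.
Qed.

Fact sq_scaleDl (p : Q) : {morph sq_scale^~ p : a b / a + b}.
Proof.
move=> a b; rewrite -(sq_repK p) -![RHS]/(sq_add _ _).
by rewrite !(sq_addE, sq_scaleE); apply: sq_mk_irr; rewrite scalerDl.
Qed.

HB.instance Definition _ := GRing.Zmodule_isLmodule.Build R Q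
  sq_scaleA sq_scale1 sq_scaleDr sq_scaleDl.

(* the class of z; meaningful for z in Z only *)
Definition cls (z : E) : Q :=
  if pselect (Z z) is left Zz then sq_mk Zz else 0.

End Subquotient.
Arguments cls {R E Z B} z.

Definition exact_at (R : realType) (U V W : lmodType R) (f : U -> V)
  (g : V -> W) : Prop := forall y, (exists x, f x = y) <-> g y = 0.

(** * Lie groupoids *)

(* [gmul g h] is meaningful when src g = tgt h only, and smooth on the
   submanifold of composable pairs.  The space of objects is Hausdorff, the
   space of arrows need not be. *)
Record lie_groupoid (R : realType) (n m : nat) := LieGroupoid {
  arr : manifold R n;
  obj : manifold R m;
  src : arr -> obj;
  tgt : arr -> obj;
  gunit : obj -> arr;
  ginv : arr -> arr;
  gmul : arr -> arr -> arr;
  src_mul : forall g h, src g = tgt h -> src (gmul g h) = src h;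
  tgt_mul : forall g h, src g = tgt h -> tgt (gmul g h) = tgt g;
  gmulA : forall g h k, src g = tgt h -> src h = tgt k ->
    gmul g (gmul h k) = gmul (gmul g h) k;
  src_unit : forall x, src (gunit x) = x;
  tgt_unit : forall x, tgt (gunit x) = x;
  gmul1 : forall g, gmul g (gunit (src g)) = g;
  gmul1l : forall g, gmul (gunit (tgt g)) g = g;
  src_inv : forall g, src (ginv g) = tgt g;
  tgt_inv : forall g, tgt (ginv g) = src g;
  gmulV : forall g, gmul g (ginv g) = gunit (tgt g);
  gmulVl : forall g, gmul (ginv g) g = gunit (src g);
  arr_countable : @second_countable arr;
  obj_countable : @second_countable obj;
  obj_hausdorff : hausdorff_space obj;
  src_submersion : @submersion R arr obj src;
  tgt_submersion : @submersion R arr obj tgt;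
  unit_smooth : @smooth R obj arr gunit;
  ginv_smooth : @smooth R arr arr ginv;
  gmul_smooth : @smooth_on R (prodc arr arr) arr
    [set p | src p.1 = tgt p.2] (fun p => gmul p.1 p.2) }.

Section Groupoid.
Variables (R : realType) (n m : nat) (Gr : lie_groupoid R n m).
Local Notation G := (arr Gr).
Local Notation M := (obj Gr).
Local Notation s := (@src R n m Gr).
Local Notation t := (@tgt R n m Gr).
Local Notation one := (@gunit R n m Gr).
Local Notation inv := (@ginv R n m Gr).
Local Notation mul := (@gmul R n m Gr).
(* T_g G and T_x M *)
Local Notation TG := 'rV[R]_n.
Local Notation TX := 'rV[R]_m.

Definition ds (g : G) (v : TG) : TX := @tmap R G M s g v.
Definition dt (g : G) (v : TG) : TX := @tmap R G M t g v.
Definition di (g : G) (v : TG) : TG := @tmap R G G inv g v.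

(* differential at [h] of the right translation by [g],
   from the s-fibre over t(g) *)
Definition rtr (g h : G) (v : TG) : TG :=
  @tmap_on R G G [set k | s k = t g] (fun k => mul k g) h v.

(* differential at [h] of the left translation by [g],
   from the t-fibre over s(g) *)
Definition ltr (g h : G) (v : TG) : TG :=
  @tmap_on R G G [set k | t k = s g] (fun k => mul g k) h v.

(* differential of the division map (p, q) |-> p q^-1 of pairs with equal
   source *)
Definition dmbar (p q : G) (v w : TG) : TG :=
  @tmap_on R (prodc G G) G [set a | s a.1 = s a.2]
    (fun a => mul a.1 (inv a.2)) (p, q) (v, w).

(* The action of g : x -> y on the isotropy Lie algebra at x: the differential
   at 1_x of the conjugation k |-> (g k) g^-1. *)
Definition Ad (g : G) (v : TG) : TG :=
  rtr (inv g) g (ltr g (one (s g)) v).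

(* Sections of A = u^* ker(ds); they are smooth as maps into the tangent bundle
   of the arrows, of which A is a submanifold. *)
Definition is_section (a : M -> TG) : Prop :=
  @smooth_along R M G setT one a /\ forall x, ds (one x) (a x) = 0.

Definition rho (a : M -> TG) : M -> TX := fun x => dt (one x) (a x).

Definition rarrow (a : M -> TG) (g : G) : TG := rtr g (one (t g)) (a (t g)).
Definition larrow (a : M -> TG) (g : G) : TG :=
  ltr g (one (s g)) (di (one (s g)) (a (s g))).

(** ** Composable strings *)

(* (g_1, ..., g_k) is indexed from 0: g_(i+1) is g i *)
Definition composable (k : nat) (g : 'I_k -> G) : Prop :=
  forall i j : 'I_k, j = i.+1 :> nat -> s (g i) = t (g j).

Definition gtail (k : nat) (g : 'I_k.+1 -> G) : 'I_k -> G :=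
  fun j => g (lift ord0 j).

Definition ginit (k : nat) (g : 'I_k.+1 -> G) : 'I_k -> G :=
  fun j => g (widen_ord (leqnSn k) j).

(* (..., g_i g_(i+1), ...), where i : nat is again counted from 0 *)
Definition gmerge (k : nat) (i : nat) (g : 'I_k.+2 -> G) : 'I_k.+1 -> G :=
  fun j => if (j < i)%N then ginit g j
           else if j == i :> nat then mul (ginit g j) (gtail g j)
           else gtail g j.

(* Maps on G^(k+1) with values in T_(g_1)G, or in A_(t g_1), are extended by
   zero to all (k+1)-tuples of arrows. *)
Definition cochain (k : nat) : Type := ('I_k.+1 -> G) -> TG.

Definition zero_ext (k : nat) (c : cochain k) : Prop :=
  forall g, ~ composable g -> c g = 0.

(** ** The deformation complex; the index k stands for the degree k+1 *)

(* For k = 0 there is no g_2, ..., and the condition on ds says that the vector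
   field c is s-projectable. *)
Definition is_def_cochain (k : nat) (c : cochain k) : Prop :=
  [/\ zero_ext c,
      @smooth_along R (powc k.+1 G) G (@composable k.+1) (fun g => g ord0) c &
      forall g h : 'I_k.+1 -> G, composable g -> composable h ->
        s (g ord0) = s (h ord0) -> gtail g = gtail h ->
        ds (g ord0) (c g) = ds (h ord0) (c h)].

Definition delta (k : nat) (c : cochain k) : cochain k.+1 := fun g =>
  if `[< composable g >] then
    - dmbar (gmerge 0 g ord0) (gtail g ord0) (c (gmerge 0 g)) (c (gtail g))
    + \sum_(1 <= i < k.+1) (-1) ^+ i.+1 *: c (gmerge i g)
    + (-1) ^+ k.+2 *: c (ginit g)
  else 0.

Definition delta_0 (a : M -> TG) : cochain 0 := fun g =>
  rarrow a (g ord0) + larrow a (g ord0).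

(** ** Cochains with values in the isotropy; k stands for the degree k+1 *)

(* the isotropy Lie algebra ker(rho_x) at x, inside T_(1_x) G *)
Definition isotropy (x : M) (v : TG) : Prop :=
  ds (one x) v = 0 /\ dt (one x) v = 0.

Definition is_iso_cochain (k : nat) (u : cochain k) : Prop :=
  [/\ zero_ext u,
      @smooth_along R (powc k.+1 G) G (@composable k.+1)
        (fun g => one (t (g ord0))) u &
      forall g, composable g -> isotropy (t (g ord0)) (u g)].

Definition delta_iso (k : nat) (u : cochain k) : cochain k.+1 := fun g =>
  if `[< composable g >] then
    Ad (g ord0) (u (gtail g))
    + \sum_(0 <= i < k.+1) (-1) ^+ i.+1 *: u (gmerge i g)
    + (-1) ^+ k.+2 *: u (ginit g)
  else 0.

Definition is_iso_section (a : M -> TG) : Prop :=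
  is_section a /\ forall x, rho a x = 0.

Definition delta_iso_0 (a : M -> TG) : cochain 0 := fun g =>
  Ad (g ord0) (a (s (g ord0))) - a (t (g ord0)).

(* u |-> c_u *)
Definition cu (k : nat) (u : cochain k) : cochain k := fun g =>
  rtr (g ord0) (one (t (g ord0))) (u g).

(** ** Cocycles, coboundaries *)

Definition is_def_cocycle (k : nat) (c : cochain k) : Prop :=
  is_def_cochain c /\ delta c = 0.

Definition is_def_coboundary (k : nat) : cochain k -> Prop :=
  match k with
  | 0 => fun c => exists2 a, is_section a & c = delta_0 a
  | k'.+1 => fun c => exists2 b, @is_def_cochain k' b & c = delta b
  end.

Definition is_iso_cocycle (k : nat) (u : cochain k) : Prop :=
  is_iso_cochain u /\ delta_iso u = 0.

Definition is_iso_coboundary (k : nat) : cochain k -> Prop :=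
  match k with
  | 0 => fun u => exists2 a, is_iso_section a & u = delta_iso_0 a
  | k'.+1 => fun u => exists2 b, @is_iso_cochain k' b & u = delta_iso b
  end.

(** ** Invariant normal vector fields *)

(* X is an (s,t)-lift of V *)
Definition is_lift (V : M -> TX) (X : G -> TG) : Prop :=
  [/\ @vector_field R M V, @vector_field R G X,
      forall g, ds g (X g) = V (s g) & forall g, dt g (X g) = V (t g)].

Definition is_liftable (V : M -> TX) : Prop := exists X, is_lift V X.

Definition is_anchored (V : M -> TX) : Prop :=
  exists2 a, is_section a & V = rho a.

(* a vector field on the arrows, as a 1-cochain *)
Definition cochain_of_vf (X : G -> TG) : cochain 0 := fun g => X (g ord0).

(** ** These are linear subspaces *)

Fact tmap_on_linear2 (S : set (G * G)) f (p : G * G) a v v' w w' :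
  @tmap_on R (prodc G G) G S f p (a *: v + v', a *: w + w') =
  a *: @tmap_on R (prodc G G) G S f p (v, w) +
  @tmap_on R (prodc G G) G S f p (v', w').
Proof. exact: (@tmap_on_linear R (prodc G G) G S f p a (v, w) (v', w')). Qed.

Fact cochain_linE k (a : R) (c d : cochain k) g :
  (a *: c + d) g = a *: c g + d g.
Proof. by []. Qed.

Fact delta_linear k : linear (@delta k).
Proof.
move=> a c d; apply/funext => g; rewrite cochain_linE /delta.
case: asboolP => _; last by rewrite scaler0 addr0.
rewrite !cochain_linE /dmbar tmap_on_linear2.
under eq_bigr do rewrite cochain_linE scalerDr scalerA mulrC -scalerA.
rewrite big_split/= -!scaler_sumr opprD -scalerN.
rewrite [(-1) ^+ _ *: (_ + _)]scalerDr scalerA [_ * a]mulrC -scalerA.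
rewrite [X in X + _]addrACA -scalerDr addrACA.
by rewrite -scalerDr.
Qed.

Fact rtr_linear g h : linear (@rtr g h).
Proof. by move=> a v w; exact: (@tmap_on_linear R G G). Qed.

Fact ltr_linear g h : linear (@ltr g h).
Proof. by move=> a v w; exact: (@tmap_on_linear R G G). Qed.

Fact di_linear g : linear (@di g).
Proof. by move=> a v w; exact: (@tmap_linear R G G). Qed.

Fact Ad_linear g : linear (@Ad g).
Proof. by move=> a v w; rewrite /Ad ltr_linear rtr_linear. Qed.

Fact ds_linear g : linear (@ds g).
Proof. by move=> a v w; exact: (@tmap_linear R G M). Qed.

Fact dt_linear g : linear (@dt g).
Proof. by move=> a v w; exact: (@tmap_linear R G M). Qed.

Fact delta_iso_linear k : linear (@delta_iso k).
Proof.
move=> a c d; apply/funext => g; rewrite cochain_linE /delta_iso.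
case: asboolP => _; last by rewrite scaler0 addr0.
rewrite !cochain_linE Ad_linear.
under eq_bigr do rewrite cochain_linE scalerDr scalerA mulrC -scalerA.
rewrite big_split/= -!scaler_sumr.
rewrite [(-1) ^+ _ *: (_ + _)]scalerDr scalerA [_ * a]mulrC -scalerA.
rewrite [X in X + _]addrACA -scalerDr addrACA.
by rewrite -scalerDr.
Qed.

Fact delta_0_linear : linear delta_0.
Proof.
move=> a c d; apply/funext => g; rewrite cochain_linE /delta_0.
rewrite /rarrow /larrow -![(_ + d) _]/(a *: c _ + d _).
by rewrite rtr_linear di_linear ltr_linear scalerDr addrACA.
Qed.

Fact delta_iso_0_linear : linear delta_iso_0.
Proof.
move=> a c d; apply/funext => g; rewrite cochain_linE /delta_iso_0.
rewrite -![(_ + d) _]/(a *: c _ + d _) Ad_linear opprD scalerBr.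
by rewrite addrACA.
Qed.

Fact rho_linear : linear rho.
Proof. by move=> a c d; apply/funext => x; exact: (@tmap_linear R G M). Qed.

Fact linear_0 (U V : lmodType R) (f : U -> V) : linear f -> f 0 = 0.
Proof. by move=> lf; have := lf (-1) 0 0; rewrite scaler0 addr0 scaleN1r addNr. Qed.

Fact smooth_first k :
  @smooth_on R (powc k.+1 G) G (@composable k.+1) (fun g => g ord0).
Proof. exact: smooth_sub (@smooth_coord R k.+1 n G ord0). Qed.

Fact smooth_one_tgt k : @smooth_on R (powc k.+1 G) G (@composable k.+1)
  (fun g => one (t (g ord0))).
Proof.
apply: (@smooth_comp R (powc k.+1 G) M G _ setT (fun g => t (g ord0))) => //.
- by move=> p i; exact: mcdom_center.
- apply: (@smooth_comp R (powc k.+1 G) G M _ setT (fun g => g ord0)) => //.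
  + by move=> p i; exact: mcdom_center.
  + exact: smooth_first.
  + exact: (tgt_submersion Gr).1.
- exact: unit_smooth.
Qed.

Fact section0 : is_section 0.
Proof.
by split=> [|x]; [exact/smooth_along0/unit_smooth|exact/linear_0/ds_linear].
Qed.

Fact section_lin a u v : is_section u -> is_section v -> is_section (a *: u + v).
Proof.
move=> [su du] [sv dv]; split=> [|x].
  exact: (smooth_along_lin a su sv).
by rewrite -[(_ + v) _]/(a *: u x + v x) ds_linear du dv scaler0 addr0.
Qed.

Fact def_cochain0 k : is_def_cochain (0 : cochain k).
Proof.
split; [by move=> g _|exact/smooth_along0/smooth_first|].
move=> g h _ _ _ _.
by rewrite (linear_0 (@ds_linear _)) (linear_0 (@ds_linear _)).
Qed.

Fact def_cochain_lin k a (u v : cochain k) : is_def_cochain u ->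
  is_def_cochain v -> is_def_cochain (a *: u + v).
Proof.
move=> [zu su pu] [zv sv pv]; split=> [g cg||g h cg ch gh gh'].
- by rewrite cochain_linE zu// zv// scaler0 addr0.
- exact: (smooth_along_lin a su sv).
- by rewrite !cochain_linE !ds_linear (pu _ h)// (pv _ h).
Qed.

Fact iso_cochain0 k : is_iso_cochain (0 : cochain k).
Proof.
split; [by move=> g _|exact/smooth_along0/smooth_one_tgt|].
by move=> g _; split; [exact/linear_0/ds_linear|exact/linear_0/dt_linear].
Qed.

Fact iso_cochain_lin k a (u v : cochain k) : is_iso_cochain u ->
  is_iso_cochain v -> is_iso_cochain (a *: u + v).
Proof.
move=> [zu su pu] [zv sv pv]; split=> [g cg||g cg].
- by rewrite cochain_linE zu// zv// scaler0 addr0.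
- exact: (smooth_along_lin a su sv).
- have [u1 u2] := pu g cg; have [v1 v2] := pv g cg.
  by split; rewrite cochain_linE ?ds_linear ?dt_linear ?u1 ?u2 ?v1 ?v2 scaler0 addr0.
Qed.

Fact def_cocycle0 k : is_def_cocycle (0 : cochain k).
Proof. by split; [exact: def_cochain0|exact/linear_0/delta_linear]. Qed.

Fact def_cocycle_lin k a (u v : cochain k) : is_def_cocycle u ->
  is_def_cocycle v -> is_def_cocycle (a *: u + v).
Proof.
move=> [cu du] [cv dv]; split; first exact: def_cochain_lin.
by rewrite delta_linear du dv scaler0 addr0.
Qed.

Fact iso_cocycle0 k : is_iso_cocycle (0 : cochain k).
Proof. by split; [exact: iso_cochain0|exact/linear_0/delta_iso_linear]. Qed.

Fact iso_cocycle_lin k a (u v : cochain k) : is_iso_cocycle u ->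
  is_iso_cocycle v -> is_iso_cocycle (a *: u + v).
Proof.
move=> [cu du] [cv dv]; split; first exact: iso_cochain_lin.
by rewrite delta_iso_linear du dv scaler0 addr0.
Qed.

Fact def_coboundary0 k : is_def_coboundary (0 : cochain k).
Proof.
case: k => [|k].
- by exists 0; [exact: section0|rewrite (linear_0 delta_0_linear)].
- by exists 0; [exact: def_cochain0|rewrite (linear_0 (@delta_linear _))].
Qed.

Fact def_coboundary_lin k a (u v : cochain k) : is_def_coboundary u ->
  is_def_coboundary v -> is_def_coboundary (a *: u + v).
Proof.
case: k u v => [|k] u v [b sb ->] [c sc ->]; exists (a *: b + c).
- exact: section_lin.
- by rewrite delta_0_linear.
- exact: def_cochain_lin.
- by rewrite delta_linear.
Qed.

Fact iso_section0 : is_iso_section 0.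
Proof. by split; [exact: section0|move=> x; exact/linear_0/dt_linear]. Qed.

Fact iso_section_lin a u v : is_iso_section u -> is_iso_section v ->
  is_iso_section (a *: u + v).
Proof.
move=> [su ru] [sv rv]; split=> [|x]; first exact: section_lin.
by rewrite rho_linear -[LHS]/(a *: rho u x + rho v x) ru rv scaler0 addr0.
Qed.

Fact iso_coboundary0 k : is_iso_coboundary (0 : cochain k).
Proof.
case: k => [|k].
- by exists 0; [exact: iso_section0|rewrite (linear_0 delta_iso_0_linear)].
- by exists 0; [exact: iso_cochain0|rewrite (linear_0 (@delta_iso_linear _))].
Qed.

Fact iso_coboundary_lin k a (u v : cochain k) : is_iso_coboundary u ->
  is_iso_coboundary v -> is_iso_coboundary (a *: u + v).
Proof.
case: k u v => [|k] u v [b sb ->] [c sc ->]; exists (a *: b + c).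
- exact: iso_section_lin.
- by rewrite delta_iso_0_linear.
- exact: iso_cochain_lin.
- by rewrite delta_iso_linear.
Qed.

Fact liftable0 : is_liftable 0.
Proof.
exists 0; split=> [||g|g]; try exact/smooth_along0/smooth_id.
- exact/linear_0/ds_linear.
- exact/linear_0/dt_linear.
Qed.

Fact liftable_lin a u v : is_liftable u -> is_liftable v ->
  is_liftable (a *: u + v).
Proof.
move=> [X [su sX uX uX']] [Y [sv sY vY vY']]; exists (a *: X + Y).
split=> [||g|g].
- exact: (smooth_along_lin a su sv).
- exact: (smooth_along_lin a sX sY).
- by rewrite -[(_ + Y) _]/(a *: X g + Y g) ds_linear uX vY.
- by rewrite -[(_ + Y) _]/(a *: X g + Y g) dt_linear uX' vY'.
Qed.

Fact anchored0 : is_anchored 0.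
Proof. by exists 0; [exact: section0|rewrite (linear_0 rho_linear)]. Qed.

Fact anchored_lin a u v : is_anchored u -> is_anchored v ->
  is_anchored (a *: u + v).
Proof.
move=> [b sb ->] [c sc ->]; exists (a *: b + c); last by rewrite rho_linear.
exact: section_lin.
Qed.

(** ** Cohomology and invariant normal fields *)

Definition def_cocycles k : subspace (cochain k) :=
  Subspace (@def_cocycle0 k) (@def_cocycle_lin k).
Definition def_coboundaries k : subspace (cochain k) :=
  Subspace (@def_coboundary0 k) (@def_coboundary_lin k).
Definition iso_cocycles k : subspace (cochain k) :=
  Subspace (@iso_cocycle0 k) (@iso_cocycle_lin k).
Definition iso_coboundaries k : subspace (cochain k) :=
  Subspace (@iso_coboundary0 k) (@iso_coboundary_lin k).
Definition liftable_fields : subspace (M -> TX) :=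
  Subspace liftable0 liftable_lin.
Definition anchored_fields : subspace (M -> TX) :=
  Subspace anchored0 anchored_lin.

End Groupoid.

Arguments cu {R n m Gr k} u.

(* cohomology in degree k+1 *)
Notation H_def Gr k := (subquot (def_cocycles Gr k) (def_coboundaries Gr k)).
Notation H_iso Gr k := (subquot (iso_cocycles Gr k) (iso_coboundaries Gr k)).

(* the classes in X(M)/rho(Gamma(A)) of the liftable vector fields *)
Notation normal_inv Gr := (subquot (liftable_fields Gr) (anchored_fields Gr)).

(** * The maps of the sequence *)

Section Maps.
Variables (R : realType) (n m : nat) (Gr : lie_groupoid R n m).

(* f is induced by u |-> c_u in degree k+1 *)
Definition is_r (k : nat) (f : H_iso Gr k -> H_def Gr k) : Prop :=
  forall u : cochain Gr k, is_iso_cocycle u ->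
    is_def_cocycle (cu u) /\ f (cls u) = cls (cu u).

(* every 1-cocycle X projects along s and t to a field V, and f [X] = [V] *)
Definition is_pi (f : H_def Gr 0 -> normal_inv Gr) : Prop :=
  forall X : arr Gr -> 'rV[R]_n, is_def_cocycle (cochain_of_vf X) ->
    (exists V, is_lift V X) /\
    (forall V, is_lift V X -> f (cls (cochain_of_vf X)) = cls V).

(* for every lift X of V there is a unique cocycle v with c_v = delta X, and
   f [V] = [v] *)
Definition is_K (f : normal_inv Gr -> H_iso Gr 1) : Prop :=
  forall (V : obj Gr -> 'rV[R]_m) (X : arr Gr -> 'rV[R]_n), is_lift V X ->
    exists v : cochain Gr 1,
      [/\ is_iso_cocycle v,
          cu v = delta (cochain_of_vf X),
          forall w : cochain Gr 1, is_iso_cocycle w ->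
            cu w = delta (cochain_of_vf X) -> w = v &
          f (cls V) = cls v].

End Maps.

(* Main.v *)
Require Import Defs.
From HB Require Import structures.
From mathcomp Require Import all_boot all_order all_algebra.
From mathcomp Require Import all_classical all_reals.
From mathcomp Require Import topology normedtype landau derive sequences.
From mathcomp Require Import interval_inference.
From mathcomp Require Import ring.

(* All differentials are computed along curves: if v is the velocity of a curve
   c lying in a subset S on which f is smooth, then the differential of f|S at v
   is the velocity of f o c.  The vectors in ker ds, and the triples of vectors
   at arrows with a common source and a common image under ds, are velocities of
   curves in the corresponding submanifold, because curves can be lifted through
   a submersion (contraction principle).  Hence every identity between
   differentials of groupoid operations reduces to a groupoid identity along
   curves.  One gets delta c_u = c_(delta u), delta delta X = 0 for an (s,t)-lift
   X and delta delta alpha = 0 for a section alpha of A, and exactness follows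
   from three facts: u |-> c_u is a bijection onto the cochains with values in
   ker ds /\ ker dt; delta alpha is an (s,t)-lift of rho(alpha); and, for a
   1-cochain X, delta X has values in ker ds iff X is an (s,t)-lift of its
   s-projection. *)

Set Implicit Arguments.
Unset Strict Implicit.
Unset Printing Implicit Defensive.

Import Order.TTheory GRing.Theory Num.Theory numFieldNormedType.Exports.

Local Open Scope classical_set_scope.
Local Open Scope ring_scope.

(** The differential along a subset, [tmap_on], is that of a local extension picked by [xget], and
    the pick changes with the base point. Its value is meaningful only on vectors tangent to the
    subset; a curve staying in the subset certifies tangency and fixes the value whatever the
    extension. This also gives smoothness in families: near a base point all the picked extensions
    can be replaced by a single one. Curves are only asked to be differentiable at the parameter 0.
    They can therefore be selected parameter by parameter and made constant away from 0, which turns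
    membership in the subset near 0 into membership for all parameters. On the isotropy side
    identities are pulled back through the injectivity of u -> c_u, so that only pointwise
    properties of [delta_iso u] have to be established. One sign has to be watched: [di] is -1 on
    the isotropy, so in degree 0 the map u -> c_u anticommutes with the differentials. *)

HB.instance Definition _ (R : realType) (m n : nat) :=
  Uniform_isComplete.Build 'M[R]_(m, n) (@cauchy_cvg 'M[R]_(m, n)).

(** * Lifting curves through submersions *)

Section Calculus.
Variable R : realType.
Implicit Types (E F G : normedModType R) (m : nat).

Lemma mxnorm_coord p q (w : 'M[R]_(p, q)) i j : `|w i j| <= `|w|.
Proof.
rewrite [leRHS]/Num.Def.normr/= mx_normrE.
exact: (le_bigmax _ (fun i : 'I_p * 'I_q => `|w i.1 i.2|) (i, j)).
Qed.

Lemma mxnorm_le p q (w : 'M[R]_(p, q)) (c : R) : 0 <= c ->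
  (forall i j, `|w i j| <= c) -> `|w| <= c.
Proof.
move=> c0 wc; rewrite [leLHS]/Num.Def.normr/= mx_normrE.
by apply: bigmax_le => // i _; exact: wc.
Qed.

(** The norm on row vectors is the sup norm, so the scalar mean value theorem, applied to each
    coordinate of [h] along the segment, is enough; the intermediate point may depend on the
    coordinate. *)
Lemma mean_value_rV E m (h : E -> 'rV[R]_m) (a b : E) (K : R) :
  (forall r, 0 <= r <= 1 -> differentiable h (a + r *: (b - a)) /\
     `|'d h (a + r *: (b - a)) (b - a)| <= K) ->
  `|h b - h a| <= K.
Proof.
move=> dh; have K0 : 0 <= K.
  by have [|_] := dh 0; [rewrite lexx ler01|exact: le_trans].
apply: mxnorm_le => // i j; rewrite (ord1 i) {i}.
pose line (r : R) := a + r *: (b - a).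
have dline (r : R) : is_diff r line ( *:%R^~ (b - a)).
  rewrite /line -[X in is_diff _ _ X]add0r.
  exact: (@is_diffD _ _ _ (cst a)).
pose f (r : R) := h (line r) 0 j.
have df (r : R) : 0 <= r <= 1 -> is_derive r 1 f ('d h (line r) (b - a) 0 j).
  move=> /dh [dhr _].
  have dl := dline r.
  pose c := fun w : 'rV[R]_m => w 0 j.
  have lc : linear c by move=> ? ? ?; rewrite /c !mxE.
  pose cM := GRing.isLinear.Build _ _ _ _ _ lc.
  pose cL : {linear 'rV[R]_m -> R} := HB.pack c cM.
  have cc : continuous cL by exact: coord_continuous.
  have dcL : differentiable cL (h (line r)) by exact: linear_differentiable.
  have dlr : differentiable line r by case: dl.
  have dhl : differentiable (h \o line) r by exact: differentiable_comp.
  have dfr : differentiable f r.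
    exact: (@differentiable_comp _ _ _ _ (h \o line) cL).
  apply: DeriveDef; first exact: diff_derivable.
  rewrite deriveE// -[f]/(cL \o (h \o line)) diff_comp//=.
  rewrite diff_comp//=.
  by rewrite (@diff_lin _ _ _ cL)// (@diff_val _ _ _ _ _ _ _ dl) scale1r.
have [||r0 r01] := @MVT_segment _ f (fun r => 'd h (line r) (b - a) 0 j) 0 1 ler01.
- by move=> r; rewrite in_itv /= => /andP[r0 r1]; apply: df; rewrite !ltW.
- apply: derivable_within_continuous => r; rewrite in_itv /= => r01.
  by case: (df r r01).
rewrite /f /line scale1r scale0r addr0 subr0 mulr1 [a + _]addrC subrK => fE.
have /dh[_] : 0 <= r0 <= 1 by [].
apply: le_trans; rewrite !mxE in fE *; rewrite fE.
exact: mxnorm_coord.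
Qed.

Lemma is_derive_comp E F (g : E -> F) (c : R -> E) (v : E) :
  is_derive (0 : R) 1 c v -> differentiable g (c 0) ->
  is_derive (0 : R) 1 (g \o c) ('d g (c 0) v).
Proof.
move=> [dc cE] dg; have dc' : differentiable c (0 : R) by exact/derivable1_diffP.
apply: DeriveDef; first exact/derivable1_diffP/differentiable_comp.
rewrite deriveE; last exact: differentiable_comp.
by rewrite diff_comp//= -[X in 'd g _ X]deriveE// cE.
Qed.

(** The difference quotient of [g] at 0 is squeezed by [C] times that of [f]. The function [g] will
    be a correction term selected pointwise, about which nothing but this bound is known. *)
Lemma is_derive_dominated E F (f : R -> E) (g : R -> F) (C : R) :
  is_derive (0 : R) 1 f 0 -> g 0 = 0 ->
  (\forall e \near (0 : R), `|g e| <= C * `|f e - f 0|) ->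
  is_derive (0 : R) 1 g 0.
Proof.
move=> [df Df] g0 gf.
suff H : h^-1 *: ((g \o shift 0) (h *: (1 : R)) - g 0) @[h --> 0^'] --> (0 : F).
  by split; [apply/cvg_ex; exists 0|exact: cvg_lim].
have H : h^-1 *: ((f \o shift 0) (h *: (1 : R)) - f 0) @[h --> 0^'] --> (0 : E).
  by rewrite -Df; exact: df.
apply/norm_cvg0P; apply: (@squeeze_cvgr _ _ _ _ (fun=> 0)
   (fun h => C * `|h^-1 *: ((f \o shift 0) (h *: (1 : R)) - f 0)|)).
- near=> h; rewrite normr_ge0 /= g0 subr0 addr0 [h *: _]mulr1 !normrZ mulrCA.
  by rewrite ler_wpM2l//; near: h; apply: nbhs_dnbhs.
- exact: cvg_cst.
- rewrite -[X in _ --> X](mulr0 C); apply: cvgM; first exact: cvg_cst.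
  exact/norm_cvg0P.
Unshelve. all: by end_near. Qed.

Lemma rV_sum_delta m (w : 'rV[R]_m) : w = \sum_j w 0 j *: delta_mx 0 j.
Proof. by rewrite [LHS]matrix_sum_delta big_ord1. Qed.

(** * Solving phi (x + sg w) = y near a point where the differential is onto *)

Section ImplicitFunction.
Variables (E : normedModType R) (m : nat) (phi : E -> 'rV[R]_m) (U : set E).
Variables (e0 : E) (sg : {linear 'rV[R]_m -> E}).
Hypotheses (oU : open U) (Ue0 : U e0) (Cphi : Ck 1 U phi).
Hypotheses (csg : continuous sg) (sgK : forall w, 'd phi e0 (sg w) = w).

(** Continuity of the differential gives closeness to the identity on each of the finitely many
    basis vectors; expanding [w] in the basis makes the estimate uniform in [w]. *)
Let near_inverse : \forall x \near e0, U x /\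
  forall w, `|w - 'd phi x (sg w)| <= 2^-1 * `|w|.
Proof.
have [dphi Cdphi] := Cphi; apply: filterI; first exact: open_nbhs_nbhs.
(* The [m] basis vectors contribute at most [c] times the norm of [w] each, hence at most half of it
   in all; [m.+1] avoids a division by zero when [m] is 0. *)
pose c : R := (2 * m.+1%:R)^-1.
have c0 : 0 < c by rewrite invr_gt0 mulr_gt0// ltr0n.
pose dlt j : 'rV[R]_m := delta_mx 0 j.
have nj : \forall x \near e0, forall j : 'I_m,
    `|dlt j - 'd phi x (sg (dlt j))| <= c.
  apply: filter_forall => j.
  have cj : (fun x => 'd phi x (sg (dlt j))) @ e0 --> dlt j.
    rewrite -[X in _ --> X](sgK (dlt j)).
    have cp : (fun x => (x, sg (dlt j))) @ e0 --> (e0, sg (dlt j)).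
      by apply: cvg_pair; [exact: cvg_id|exact: cvg_cst].
    exact: (cvg_comp _ _ cp (Cdphi (e0, sg (dlt j)) Ue0)).
  by move/cvgrPdist_le: cj; exact.
apply: filterS nj => x nj w.
have -> : w - 'd phi x (sg w) =
    \sum_j w 0 j *: (dlt j - 'd phi x (sg (dlt j))).
  rewrite [in LHS](rV_sum_delta w) !linear_sum -big_split/=.
  by apply: eq_bigr => j _; rewrite scalerBr !linearZ.
apply: le_trans (ler_norm_sum _ _ _) _.
apply: (@le_trans _ _ (\sum_(j < m) `|w| * c)).
  apply: ler_sum => j _; rewrite normrZ.
  by apply: ler_pM => //; exact: mxnorm_coord.
rewrite sumr_const card_ord -[leLHS]mulr_natr -mulrA [leRHS]mulrC ler_wpM2l//.
rewrite /c invfM -mulrA ger_pMr ?invr_gt0// ler_pdivrMl ?ltr0n// mulr1 ler_nat.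
exact: leqW.
Qed.

(* The map w |-> w - (phi (x + sg w) - y) is a contraction by 1/2. *)
Lemma local_solve : exists2 d : R, 0 < d & forall x y,
  `|e0 - x| < d -> `|phi e0 - y| < d -> exists w,
  `|w| <= 2 * `|phi x - y| /\ phi (x + sg w) = y.
Proof.
have [dphi _] := Cphi.
have [k k0 sgk] := linear_lipschitz csg.
have [d /= d0 dP] := (nbhs_normP _ _).1 near_inverse.
(* As [k] is a Lipschitz constant of [sg], a vector [w] of norm at most [r] moves x by at most d /
   2, and x + sg w stays in the ball of radius [d] where [near_inverse] holds. *)
pose r : R := d / (2 * k).
have r0 : 0 < r by rewrite divr_gt0// mulr_gt0.
have cphi : phi @ e0 --> phi e0.
  exact: (differentiable_continuous (dphi _ Ue0)).
have r4 : 0 < r / 2 / 2 by do 2 apply: divr_gt0 => //.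
have n0 : \forall x \near e0, `|phi e0 - phi x| < r / 2 / 2.
  by move/cvgrPdist_lt: cphi; exact.
have [d' /= d'0 d'P] := (nbhs_normP _ _).1 n0.
exists (Num.min (d / 2) (Num.min d' (r / 2 / 2))).
  by rewrite !lt_min d'0 r4 divr_gt0.
move=> x y; rewrite !lt_min => /and3P[n2 /d'P /= n1 _] /and3P[_ _ ny].
(* Twice the norm of T 0: a contraction by 1/2 maps the ball of this radius into itself. The bounds
   r / 4 on the distances from phi e0 to phi x and to y give rr < r. *)
pose rr := 2 * `|phi x - y|.
have rr_r : rr < r.
  rewrite /rr mulrC -ltr_pdivlMr// (splitr (r / 2)).
  apply: le_lt_trans (ler_distD (phi e0) _ _) _.
  by rewrite [`|phi x - _|]distrC; exact: ltrD.
have xsg w : `|w| <= rr -> U (x + sg w) /\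
    forall z, `|z - 'd phi (x + sg w) (sg z)| <= 2^-1 * `|z|.
  move=> wrr; apply: dP; rewrite /= opprD addrA (le_lt_trans (ler_normB _ _))//.
  rewrite (splitr d) ltr_leD//.
  apply: le_trans (sgk w) _; rewrite -ler_pdivlMl//.
  apply: le_trans wrr (le_trans (ltW rr_r) _).
  by rewrite /r invfM mulrA mulrC mulrA.
pose T w := w - (phi (x + sg w) - y).
have Tdist a b : `|a| <= rr -> `|b| <= rr -> `|T b - T a| <= 2^-1 * `|b - a|.
  move=> arr brr; apply: mean_value_rV => z z01.
  set w := a + z *: (b - a).
  have wrr : `|w| <= rr.
    have -> : w = (1 - z) *: a + z *: b.
      by rewrite /w scalerBr scalerBl scale1r addrA addrAC.
    apply: le_trans (ler_normD _ _) _; rewrite !normrZ.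
    have /andP[z0 z1] := z01.
    rewrite (ger0_norm z0) ger0_norm ?subr_ge0//.
    have -> : rr = (1 - z) * rr + z * rr by ring.
    by apply: lerD; apply: ler_wpM2l => //; rewrite subr_ge0.
  have [Uw dw] := xsg w wrr.
  have dshift : is_diff w (fun w => x + sg w) sg.
    rewrite -[X in is_diff _ _ X]add0r.
    apply: (@is_diffD _ _ _ (cst x)).
    by apply: DiffDef; [exact: linear_differentiable|rewrite diff_lin].
  have dps : is_diff w (phi \o (fun w => x + sg w)) ('d phi (x + sg w) \o sg).
    by apply: is_diff_comp => //; apply: differentiableP; exact: dphi.
  have dT : is_diff w T (id - (('d phi (x + sg w) \o sg) - 0)).
    rewrite -[T]/(id - ((phi \o (fun w => x + sg w)) - cst y)).
    exact: is_diffB.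
  split; first by case: dT.
  by rewrite (@diff_val _ _ _ _ _ _ _ dT) /= !fctE /= subr0; exact: dw.
have rr0 : 0 <= rr by rewrite mulr_ge0.
have TB : set_fun [set w | `|w| <= rr] [set w | `|w| <= rr] T.
  move=> w /= wrr; rewrite -[T w](subrK (T 0)).
  have /le_trans -> // : `|T w - T 0 + T 0| <= 2^-1 * `|w| + 2^-1 * rr.
    apply: le_trans (ler_normD _ _) _; apply: lerD.
      by have := @Tdist 0 w; rewrite subr0 normr0; exact.
    by rewrite /T linear0 addr0 sub0r normrN /rr mulKf// pnatr_eq0.
  by rewrite [leRHS](splitr rr) [rr / 2]mulrC lerD2r ler_wpM2l// invr_ge0 ler0n.
pose TF : {fun [set w | `|w| <= rr] >-> [set w | `|w| <= rr]} := mkfun_fun TB.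
have half0 : 0 <= 2^-1 :> R by rewrite invr_ge0 ler0n.
have TFc : is_contraction TF.
  exists (NngNum half0); split => /=; first by rewrite invf_lt1// ltr1n.
  by move=> [a b] /= [arr brr]; exact: Tdist.
have [|| w wrr wE] := @banach_fixed_point R 'rV[R]_m _ TF TFc.
- have -> : [set w : 'rV[R]_m | `|w| <= rr] =
      Num.norm @^-1` [set y : R | y <= rr] by [].
  apply: closed_comp; last exact: closed_le.
  by move=> z _; exact: norm_continuous.
- by exists 0; rewrite /= normr0.
exists w; split=> //; move: wE; rewrite /= /T => /eqP.
by rewrite -subr_eq0 opprB addrC subrK subr_eq0 => /eqP.
Qed.

(** The line e0 + e v is corrected by the solution [w e] of [local_solve]. The line already has the
    right image to first order, so the residual phi (line e) - g e has derivative 0; it dominates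
    [w], and the correction does not change the velocity. *)
Lemma lift_curve_rV (g : R -> 'rV[R]_m) (v : E) :
  g 0 = phi e0 -> is_derive (0 : R) 1 g ('d phi e0 v) ->
  exists c : R -> E, [/\ c 0 = e0, is_derive (0 : R) 1 c v &
    \forall e \near (0 : R), phi (c e) = g e].
Proof.
move=> g0 dg; have [dphi _] := Cphi.
pose line (e : R) := e0 + e *: v.
have dline : is_diff (0 : R) line ( *:%R^~ v).
  rewrite /line -[X in is_diff _ _ X]add0r.
  exact: (@is_diffD _ _ _ (cst e0)).
have line0 : line 0 = e0 by rewrite /line scale0r addr0.
have dlr : differentiable line (0 : R) by case: dline.
have dl : is_derive (0 : R) 1 line v.
  apply: DeriveDef; first exact: diff_derivable.
  by rewrite deriveE// (@diff_val _ _ _ _ _ _ _ dline) scale1r.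
have cline : line @ (0 : R) --> e0.
  by rewrite -[X in _ --> X]line0; exact: differentiable_continuous.
have cg : g @ (0 : R) --> phi e0.
  by rewrite -g0; apply: differentiable_continuous; case: dg => /derivable1_diffP.
have [w wP] : exists w : R -> 'rV[R]_m, \forall e \near (0 : R),
    `|w e| <= 2 * `|phi (line e) - g e| /\ phi (line e + sg (w e)) = g e.
  pose P e (w : 'rV[R]_m) := `|w| <= 2 * `|phi (line e) - g e| /\
    phi (line e + sg w) = g e.
  exists (fun e => xget 0 (P e)); have [d d0 solve] := local_solve.
  have n1 : \forall e \near (0 : R), `|e0 - line e| < d.
    by move/cvgrPdist_lt : cline; apply.
  have n2 : \forall e \near (0 : R), `|phi e0 - g e| < d.
    by move/cvgrPdist_lt : cg; apply.
  apply: filterS2 n1 n2 => e n1 n2; have [w Pw] := solve _ _ n1 n2.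
  exact: (@xgetPex _ 0 (P e) (ex_intro _ w Pw)).
have w0 : w 0 = 0.
  have [+ _] := nbhs_singleton wP.
  by rewrite line0 g0 subrr normr0 mulr0 normr_le0 => /eqP.
have dphil : is_derive (0 : R) 1 ((phi \o line) - g) 0.
  have dp0 : differentiable phi (line 0) by rewrite line0; exact: dphi.
  have dpl := is_derive_comp dl dp0; rewrite line0 in dpl.
  by rewrite -(subrr ('d phi e0 v)); exact: is_deriveB.
have dw : is_derive (0 : R) 1 w 0.
  apply: (is_derive_dominated (C := 2) dphil w0).
  by apply: filterS wP => e [+ _]; rewrite /= !fctE /= line0 g0 subrr subr0.
exists (fun e => line e + sg (w e)); split.
- by rewrite line0 w0 linear0 addr0.
- have dsg : differentiable sg (w 0) by exact: linear_differentiable.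
  have := is_derive_comp dw dsg; rewrite linear0 => ds.
  by rewrite -[X in is_derive _ _ _ X]addr0; exact: is_deriveD.
- by apply: filterS wP => e [].
Qed.

End ImplicitFunction.

Lemma linear_right_inverse E m (L : {linear E -> 'rV[R]_m}) :
  (forall w, exists v, L v = w) ->
  exists2 sg : {linear 'rV[R]_m -> E}, continuous sg & forall w, L (sg w) = w.
Proof.
move=> surj; have [u uP] := choice (fun j : 'I_m => surj (delta_mx 0 j)).
have lsg : linear (fun w : 'rV[R]_m => \sum_j w 0 j *: u j).
  move=> a v w; rewrite scaler_sumr -big_split/=; apply: eq_bigr => j _.
  by rewrite !mxE scalerDl scalerA.
pose sgM := GRing.isLinear.Build _ _ _ _ _ lsg.
pose sg : {linear 'rV[R]_m -> E} :=
  HB.pack (fun w : 'rV[R]_m => \sum_j w 0 j *: u j) sgM.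
exists sg.
  apply: continuous_big => [|j _ w]; first exact: add_continuous.
  have c1 : {for w, continuous (fun w : 'rV[R]_m => w 0 j)}.
    exact: coord_continuous.
  exact: (continuous_comp c1 (@scalel_continuous _ _ (u j) (w 0 j))).
move=> w; rewrite /= linear_sum [RHS]rV_sum_delta; apply: eq_bigr => j _.
by rewrite linearZ/= uP.
Qed.

(** * Products and tangent maps in normed spaces *)

Lemma is_derive_pair E F (c : R -> E) (d : R -> F) (v : E) (w : F) :
  is_derive (0 : R) 1 c v -> is_derive (0 : R) 1 d w ->
  is_derive (0 : R) 1 (fun e => (c e, d e)) (v, w).
Proof.
move=> [dc cE] [dd dE].
have dc' : differentiable c (0 : R) by exact/derivable1_diffP.
have dd' : differentiable d (0 : R) by exact/derivable1_diffP.
apply: DeriveDef; first exact/derivable1_diffP/differentiable_pair.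
rewrite deriveE; last exact: differentiable_pair.
by rewrite diff_pair//= -!deriveE// cE dE.
Qed.

Lemma is_derive_continuous E (c : R -> E) (v : E) :
  is_derive (0 : R) 1 c v -> c @ (0 : R) --> c 0.
Proof. by move=> [/derivable1_diffP dc _]; exact: differentiable_continuous. Qed.

Lemma fst_continuous E F : continuous (fst : E * F -> E).
Proof. by move=> p; exact: cvg_fst. Qed.

Lemma snd_continuous E F : continuous (snd : E * F -> F).
Proof. by move=> p; exact: cvg_snd. Qed.

Lemma Ck_fst k E F (U : set (E * F)) : Ck k U (fst : E * F -> E).
Proof. exact: (@Ck_lin _ k (E * F)%type E _ fst (@fst_continuous E F)). Qed.

Lemma Ck_snd k E F (U : set (E * F)) : Ck k U (snd : E * F -> F).
Proof. exact: (@Ck_lin _ k (E * F)%type F _ snd (@snd_continuous E F)). Qed.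

Lemma Cinfty_differentiable E F (U : set E) (f : E -> F) x :
  Cinfty U f -> U x -> differentiable f x.
Proof. by move=> Cf Ux; have [df _] := Cf 1%N; exact: df. Qed.

Lemma is_diff_fst E F (z : E * F) : is_diff z fst fst.
Proof.
pose f : {linear (E * F)%type -> E} := fst.
have cf : continuous f by exact: fst_continuous.
have df : differentiable f z by exact: linear_differentiable.
have Df : 'd f z = f :> (_ -> _) by exact: diff_lin.
by apply: DiffDef.
Qed.

Lemma is_diff_snd E F (z : E * F) : is_diff z snd snd.
Proof.
pose f : {linear (E * F)%type -> F} := snd.
have cf : continuous f by exact: snd_continuous.
have df : differentiable f z by exact: linear_differentiable.
have Df : 'd f z = f :> (_ -> _) by exact: diff_lin.
by apply: DiffDef.
Qed.

Lemma is_diff_prod E F E' F' (g : E -> E') (h : F -> F') x y :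
  differentiable g x -> differentiable h y ->
  is_diff (x, y) (fun p => (g p.1, h p.2)) (fun p => ('d g x p.1, 'd h y p.2)).
Proof.
move=> /differentiableP dg /differentiableP dh.
have d1 := is_diff_fst (x, y).
have d2 := is_diff_snd (x, y).
apply: (@is_diff_pair _ _ _ _ (g \o fst) ('d g x \o fst) (h \o snd)
  ('d h y \o snd)); exact: is_diff_comp.
Qed.

(** This is the tangent map of [f] after [H], whose first component is a base point and whose second
    is a vector. One order of smoothness of [f] is spent on the differential, harmless for smooth
    maps. *)
Lemma Cinfty_tangent E F G (U : set E) (V : set F) (H : E -> F * F) (f : F -> G) :
  open U -> open V -> Cinfty U H -> Cinfty V f ->
  open (U `&` [set e | V (H e).1]) /\
  Cinfty (U `&` [set e | V (H e).1]) (fun e => (f (H e).1, 'd f ((H e).1) (H e).2)).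
Proof.
move=> oU oV CH Cf.
have oUV : open (U `&` [set e | V (H e).1]).
  rewrite openE => e [Ue Ve]; apply: filterI; first exact: open_nbhs_nbhs.
  have cH : (fun e => (H e).1) @ e --> (H e).1.
    exact: (continuous_comp (CH 0%N e Ue) (@fst_continuous _ _ (H e))).
  have nV : nbhs (H e).1 V by exact: open_nbhs_nbhs.
  exact: (cH _ nV).
split=> // k.
have CHk : Ck k (U `&` [set e | V (H e).1]) H by apply: (Ck_sub _ (CH k)) => e [].
pose df (q : F * F) := 'd f (q.1) q.2.
have Cdf : Ck k [set q : F * F | V q.1] df by have [] := Cf k.+1.
have oV1 : open [set q : F * F | V q.1].
  by apply: open_comp => // q _; exact: fst_continuous.
have C1 : Ck k [set q : F * F | V q.1] (f \o fst).
  by apply: (Ck_comp oV1 oV _ (@Ck_fst _ _ _ _) (Cf k)).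
have C2 := Ck_pair oV1 C1 Cdf.
by apply: (Ck_comp oUV oV1 _ CHk C2) => e [].
Qed.

(** The two middle factors are exchanged: in the tangent bundle of a product the pair of base points
    precedes the pair of vectors. *)
Lemma Cinfty_pair_tangent E F G (U U' : set E) (H : E -> F * F) (H' : E -> G * G) :
  open U -> open U' -> Cinfty U H -> Cinfty U' H' ->
  Cinfty (U `&` U') (fun e => (((H e).1, (H' e).1), ((H e).2, (H' e).2))).
Proof.
move=> oU oU' CH CH' k; have oUU' := openI oU oU'.
have C1 : Ck k (U `&` U') H by apply: (Ck_sub _ (CH k)) => e [].
have C2 : Ck k (U `&` U') H' by apply: (Ck_sub _ (CH' k)) => e [].
have Cf (A B : normedModType R) (h : E -> A * B) :
    Ck k (U `&` U') h -> Ck k (U `&` U') (fun e => (h e).1).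
  by move=> Ch; exact: (Ck_comp oUU' openT _ Ch (@Ck_fst _ _ _ setT)).
have Cs (A B : normedModType R) (h : E -> A * B) :
    Ck k (U `&` U') h -> Ck k (U `&` U') (fun e => (h e).2).
  by move=> Ch; exact: (Ck_comp oUU' openT _ Ch (@Ck_snd _ _ _ setT)).
exact: (Ck_pair oUU' (Ck_pair oUU' (Cf _ _ _ C1) (Cf _ _ _ C2))
                     (Ck_pair oUU' (Cs _ _ _ C1) (Cs _ _ _ C2))).
Qed.

End Calculus.

(** * Velocities of curves *)

Section Velocity.
Variable R : realType.
Implicit Types X Y Z : charted R.

(* The properties of manifolds that pass to [prodc], which puts no topology on
   the points. *)
Record atlas X : Prop := Atlas {
  atlas_center : forall p, cdom X p p;
  atlas_open : forall p, nbhs (chart X p p) (chart X p @` cdom X p);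
  atlas_chartK : forall p q, cdom X p q -> chartV X p (chart X p q) = q;
  atlas_dom : forall p q, cdom X p q ->
    \forall e \near chart X q q, cdom X p (chartV X q e);
  atlas_diff : forall p q, cdom X p q ->
    differentiable (chart X p \o chartV X q) (chart X q q) }.

Lemma atlas_manifold n (X : manifold R n) : atlas X.
Proof.
have near_dom (p q : X) : mcdom p q ->
    \forall e \near mchart q q, mcdom p (mchartV q e).
  move=> pq; have qq := mcdom_center q.
  have cq : mchartV q @ mchart q q --> mchartV q (mchart q q).
    by apply: mchartV_cont; exists q.
  rewrite mchartK// in cq.
  have np : nbhs q (mcdom p).
    by apply: open_nbhs_nbhs; split=> //; exact: mcdom_open.
  exact: (cq _ np).
split=> [p|p|p q|p q|p q pq].
- exact: mcdom_center.
- apply: open_nbhs_nbhs; split; first exact: mchart_open.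
  by exists p => //; exact: mcdom_center.
- exact: mchartK.
- exact: near_dom.
- have [+ _] := @mchart_smooth R n X q p 1%N; apply.
  by exists q => //; split => //; exact: mcdom_center.
Qed.

Lemma atlas_prodc X Y : atlas X -> atlas Y -> atlas (prodc X Y).
Proof.
move=> aX aY; split=> [p|p|[p p'] [q q'] [pq pq']|[p p'] [q q'] [pq pq']|].
- by split; exact: atlas_center.
- pose e0 : model X * model Y := (chart X p.1 p.1, chart Y p.2 p.2).
  have n1 : \forall e \near e0, (chart X p.1 @` cdom X p.1) e.1 :=
    @fst_continuous _ _ _ e0 _ (atlas_open aX p.1).
  have n2 : \forall e \near e0, (chart Y p.2 @` cdom Y p.2) e.2 :=
    @snd_continuous _ _ _ e0 _ (atlas_open aY p.2).
  apply: filterS2 n1 n2 => -[_ _] /= [a pa <-] [b pb <-]; by exists (a, b).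
- by rewrite /= (atlas_chartK aX pq) (atlas_chartK aY pq').
- pose e0 : model X * model Y := (chart X q q, chart Y q' q').
  have n1 : \forall e \near e0, cdom X p (chartV X q e.1) :=
    @fst_continuous _ _ _ e0 _ (atlas_dom aX pq).
  have n2 : \forall e \near e0, cdom Y p' (chartV Y q' e.2) :=
    @snd_continuous _ _ _ e0 _ (atlas_dom aY pq').
  exact: filterS2 n1 n2.
- move=> [p p'] [q q'] [pq pq'] /=.
  by case: (is_diff_prod (atlas_diff aX pq) (atlas_diff aY pq')).
Qed.

(** The vector is read in the preferred chart at [p], as in [TM]. Nothing is asked of the curve away
    from the parameter 0, not even continuity. *)
Definition velocity X (c : R -> pt X) (p : pt X) (v : model X) : Prop :=
  [/\ c 0 = p, \forall e \near (0 : R), cdom X p (c e) &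
      is_derive (0 : R) 1 (chart X p \o c) v].

Lemma velocity_unique X (c : R -> pt X) p v w :
  velocity c p v -> velocity c p w -> v = w.
Proof. by move=> [_ _ [_ <-]] [_ _ [_ <-]]. Qed.

Lemma velocity_cst X p : atlas X -> @velocity X (fun=> p) p 0.
Proof.
move=> aX; split=> //; last exact: (is_derive_cst (chart X p p) (0 : R) 1).
by near=> e; exact: atlas_center.
Unshelve. all: by end_near. Qed.

(** Needed because smoothness along a map reads vectors at all nearby points in the one chart at the
    base point, whereas a velocity lives in the chart at its own point. *)
Lemma velocity_chart X (c : R -> pt X) p q v : atlas X -> velocity c p v ->
  cdom X q p -> (\forall e \near (0 : R), cdom X q (c e)) /\
  is_derive (0 : R) 1 (chart X q \o c)
    ('d (chart X q \o chartV X p) (chart X p p) v).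
Proof.
move=> aX [c0 cp dc] qp.
have cE : \forall e \near (0 : R), chartV X p (chart X p (c e)) = c e.
  by apply: filterS cp => e; exact: atlas_chartK.
split.
  have cc := is_derive_continuous dc; rewrite /= c0 in cc.
  have := cc _ (atlas_dom aX qp); rewrite nbhs_simpl /= => H.
  by apply: filterS2 cE H => e <-.
have dcq : differentiable (chart X q \o chartV X p) ((chart X p \o c) 0).
  by rewrite /= c0; exact: atlas_diff.
have := is_derive_comp dc dcq; rewrite [(chart X p \o c) 0]/= c0 => dcE.
apply: (near_eq_is_derive _ dcE).
by apply: filterS cE => e /= ->.
Qed.

(** An extension agrees with [f] on [S] only, hence along a curve in [S]. As the velocity of f o c
    does not mention [F], the differential of every extension takes the same value on [v]. *)
Lemma velocity_local_ext X Y (S : set (pt X)) (f : pt X -> pt Y) p F c v :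
  @local_ext R X Y S f p F -> velocity c p v -> (forall e, S (c e)) ->
  velocity (f \o c) (f p) ('d F (chart X p p) v).
Proof.
move=> [U [oU Up CF FE]] [c0 cp dc] Sc.
have cU : \forall e \near (0 : R), U (chart X p (c e)).
  have := is_derive_continuous dc; rewrite /= c0 => cc.
  by have nU : nbhs (chart X p p) U; [exact: open_nbhs_nbhs|exact: (cc _ nU)].
split=> /=; first by rewrite c0.
  by apply: filterS2 cp cU => e pc Uc; have [] := FE _ (Sc e) pc Uc.
have dF := Cinfty_differentiable CF Up.
have := is_derive_comp (g := F) dc; rewrite /= c0 => /(_ dF) dFc.
apply: (near_eq_is_derive _ dFc).
by apply: filterS2 cp cU => e pc Uc; have [_ /= ->] := FE _ (Sc e) pc Uc.
Qed.

Lemma velocity_tmap_on X Y (S : set (pt X)) (f : pt X -> pt Y) p c v :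
  smooth_on S f -> velocity c p v -> (forall e, S (c e)) ->
  velocity (f \o c) (f p) (tmap_on S f p v).
Proof.
move=> sf cv Sc; have Sp : S p by have [<- _ _] := cv.
have FE : [set F | @local_ext R X Y S f p F]
    (xget (fun=> 0) [set F | @local_ext R X Y S f p F]).
  exact: xgetPex (sf p Sp).
exact: velocity_local_ext FE cv Sc.
Qed.

Lemma tmap_local_ext X Y (f : pt X -> pt Y) p F : atlas X ->
  @local_ext R X Y setT f p F -> tmap f p = 'd F (chart X p p).
Proof.
move=> aX [U [oU Up CF FE]]; apply/funext => v; rewrite /tmap.
have dF := Cinfty_differentiable CF Up.
have [|_ -> //] := @diff_near _ _ _ F (chart Y (f p) \o f \o chartV X p) _ _ dF.
have oU' : \forall e \near chart X p p, U e by exact: open_nbhs_nbhs.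
apply: filterS2 (atlas_open aX p) oU' => _ [q pq <-] Uq /=.
by rewrite (atlas_chartK aX pq); have [_ ->] := FE q I pq Uq.
Qed.

Lemma velocity_tmap X Y (f : pt X -> pt Y) p c v :
  atlas X -> smooth f -> velocity c p v -> velocity (f \o c) (f p) (tmap f p v).
Proof.
move=> aX sf cv; have [F FE] := sf p I.
by rewrite (tmap_local_ext aX FE); exact: velocity_local_ext FE cv _.
Qed.

Lemma velocity_exists X p (v : model X) : atlas X -> exists c, velocity c p v.
Proof.
move=> aX; pose line (e : R) := chart X p p + e *: v.
have line0 : line 0 = chart X p p by rewrite /line scale0r addr0.
have dline : is_derive (0 : R) 1 line v.
  have dl : is_diff (0 : R) line ( *:%R^~ v).
    rewrite /line -[X in is_diff _ _ X]add0r.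
    exact: (@is_diffD _ _ _ (cst (chart X p p))).
  have dl' : differentiable line (0 : R) by case: dl.
  apply: DeriveDef; first exact: diff_derivable.
  by rewrite deriveE// (@diff_val _ _ _ _ _ _ _ dl) scale1r.
have cline := is_derive_continuous dline; rewrite line0 in cline.
exists (chartV X p \o line); split => /=.
- by rewrite line0 atlas_chartK//; exact: atlas_center.
- exact: (cline _ (atlas_dom aX (atlas_center aX p))).
- apply: (near_eq_is_derive _ dline).
  have := cline _ (atlas_open aX p); rewrite nbhs_simpl /=.
  by apply: filterS => e [q pq <-] /=; rewrite (atlas_chartK aX pq).
Qed.

Lemma tmap_onT X Y (f : pt X -> pt Y) p v : atlas X -> smooth f ->
  tmap_on setT f p v = tmap f p v.
Proof.
move=> aX sf; have [c cv] := velocity_exists p v aX.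
apply: velocity_unique (velocity_tmap aX sf cv).
exact: velocity_tmap_on cv _.
Qed.

Lemma velocity_pair X Y (c : R -> pt X) (d : R -> pt Y) p q v w :
  velocity c p v -> velocity d q w ->
  @velocity (prodc X Y) (fun e => (c e, d e)) (p, q) (v, w).
Proof.
move=> [c0 cp dc] [d0 dq dd]; split; first by rewrite c0 d0.
  by apply: filterS2 cp dq.
exact: is_derive_pair dc dd.
Qed.

Lemma velocity_comp2 X Y Z (S : set (pt (prodc X Y))) f p q c d v w :
  @smooth_on R (prodc X Y) Z S f -> velocity c p v -> velocity d q w ->
  (forall e, S (c e, d e)) ->
  velocity (fun e => f (c e, d e)) (f (p, q))
    (@tmap_on R (prodc X Y) Z S f (p, q) (v, w)).
Proof.
move=> sf cv dw Scd.
exact: (@velocity_tmap_on (prodc X Y) Z S f _ _ _ sf (velocity_pair cv dw)).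
Qed.

(** [lift_curve_rV] read in the charts at [p] and [f p]. It yields an equality of coordinates in
    [Y], which becomes an equality of points by applying [chartV]. *)
Lemma submersion_lift m X (Y : manifold R m) f p v (g : R -> Y) :
  atlas X -> @submersion R X Y f -> @velocity Y g (f p) (tmap f p v) ->
  exists2 c, velocity c p v & \forall e \near (0 : R), f (c e) = g e.
Proof.
move=> aX [sf ssub] [g0 gp dg]; have aY := atlas_manifold Y.
have [F FE] := sf p I; have dfE := tmap_local_ext aX FE.
have [U [oU Up CF FP]] := FE.
have [_ FEp] := FP p I (atlas_center aX p) Up.
rewrite dfE in dg.
have surj w : exists u, 'd F (chart X p p) u = w.
  by have [u uw] := ssub p w; exists u; rewrite -dfE.
have [sg csg sgK] := linear_right_inverse surj.
have g0E : (chart Y (f p) \o g) 0 = F (chart X p p) by rewrite -FEp /comp g0.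
have [c [c0 dc cP]] := lift_curve_rV oU Up (CF 1%N) csg sgK g0E dg.
have cc := is_derive_continuous dc; rewrite c0 in cc.
have nc : \forall e \near (0 : R), (chart X p @` cdom X p) (c e) :=
  cc _ (atlas_open aX p).
have nU : nbhs (chart X p p) U by exact/open_nbhs_nbhs/(conj oU Up).
have ncU : \forall e \near (0 : R), U (c e) := cc _ nU.
exists (chartV X p \o c).
  split.
  - by rewrite /= c0 (atlas_chartK aX (atlas_center aX p)).
  - by apply: filterS nc => e [q pq qc] /=; rewrite -qc (atlas_chartK aX pq).
  - apply: (near_eq_is_derive _ dc); apply: filterS nc => e [q pq qc] /=.
    by rewrite -qc (atlas_chartK aX pq).
apply: filterS3 (filterI nc ncU) cP gp => e [[q pq qc] Ue] Fe gpe.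
have Uq : U (chart X p q) by rewrite qc.
have [fpq FEq] := FP q I pq Uq.
rewrite /= -qc (atlas_chartK aX pq).
have fgE : chart Y (f p) (f q) = chart Y (f p) (g e) by rewrite FEq qc Fe.
by rewrite -(atlas_chartK aY fpq) fgE (atlas_chartK aY gpe).
Qed.

Lemma velocity_near X (c d : R -> pt X) p v :
  (\forall e \near (0 : R), c e = d e) -> velocity c p v -> velocity d p v.
Proof.
move=> cd [c0 cp dc]; split.
- by rewrite -(nbhs_singleton cd).
- by apply: filterS2 cd cp => e ->.
- by apply: (near_eq_is_derive _ dc); apply: filterS cd => e /= ->.
Qed.

Lemma velocity_eq X (c d : R -> pt X) p q v :
  velocity c p v -> (forall e, c e = d e) -> p = q -> velocity d q v.
Proof. by move=> cv /funext <- <-. Qed.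

(** A constant curve of [Y] is lifted. The lift lies in the fibre only near 0, so it is replaced by
    the constant [p] at the other parameters. *)
Lemma fibre_curve m X (Y : manifold R m) f p v :
  atlas X -> @submersion R X Y f -> tmap f p v = 0 ->
  exists2 c, velocity c p v & forall e, f (c e) = f p.
Proof.
move=> aX fsub dfv.
have v0 := velocity_cst (f p) (atlas_manifold Y); rewrite -dfv in v0.
have [c cv fc] := submersion_lift aX fsub v0.
exists (fun e => if `[< f (c e) = f p >] then c e else p).
  by apply: velocity_near cv; apply: filterS fc => e fe; rewrite asboolT.
by move=> e; case: asboolP.
Qed.

(** * Smooth maps into products, and smoothness of differentials along sections *)

Lemma smooth_cst X Y (q : pt Y) : atlas Y -> @smooth R X Y (fun=> q).
Proof.
move=> aY p _; exists (fun=> chart Y q q), setT; split=> //; first exact: openT.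
  by move=> k; exact: Ck_cst.
by move=> *; split=> //; exact: atlas_center.
Qed.

Lemma smooth_fst X Y : @smooth R (prodc X Y) X fst.
Proof.
move=> p _; exists fst, setT; split=> //; first exact: openT.
  by move=> k; exact: Ck_fst.
by move=> q _ [].
Qed.

Lemma smooth_snd X Y : @smooth R (prodc X Y) Y snd.
Proof.
move=> p _; exists snd, setT; split=> //; first exact: openT.
  by move=> k; exact: Ck_snd.
by move=> q _ [].
Qed.

Lemma smooth_on_eq X Y (S : set (pt X)) (f g : pt X -> pt Y) :
  (forall p, S p -> f p = g p) -> smooth_on S f -> smooth_on S g.
Proof.
move=> fg sf p Sp; have [F [U [oU Up CF FE]]] := sf p Sp.
by exists F, U; split=> // q Sq pq Uq; rewrite -!fg//; exact: FE.
Qed.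

Lemma smooth_on_pair X Y Z (S : set (pt X)) (f : pt X -> pt Y) (g : pt X -> pt Z) :
  smooth_on S f -> smooth_on S g ->
  @smooth_on R X (prodc Y Z) S (fun p => (f p, g p)).
Proof.
move=> sf sg p Sp; have [F [U [oU Up CF FE]]] := sf p Sp.
have [F' [U' [oU' Up' CF' FE']]] := sg p Sp.
exists (fun e => (F e, F' e)), (U `&` U'); split=> //; first exact: openI.
  move=> k; apply: Ck_pair; first exact: openI.
    by apply: (Ck_sub _ (CF k)) => e [].
  by apply: (Ck_sub _ (CF' k)) => e [].
move=> q Sq pq [Uq Uq']; have [fpq E1] := FE q Sq pq Uq.
have [gpq E2] := FE' q Sq pq Uq'.
by split=> //=; rewrite E1 E2.
Qed.

(** With [k] equal to 1 this is the identification of a manifold with its first power, by which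
    1-cochains become vector fields. *)
Lemma smooth_diagonal n k (X : manifold R n) :
  @smooth R X (powc k X) (fun p _ => p).
Proof.
move=> p _; pose F (e : 'rV[R]_n) : 'M[R]_(k, n) := \matrix_(i < k) e.
have lF : linear F by move=> a v w; apply/matrixP => i j; rewrite !mxE.
pose FM := GRing.isLinear.Build _ _ _ _ _ lF.
pose FL : {linear 'rV[R]_n -> 'M[R]_(k, n)} := HB.pack F FM.
exists F, setT; split=> //; first exact: openT.
  move=> l; apply: (@Ck_lin _ l _ _ _ FL).
  move=> /= A s /= /nbhs_ballP[e e0 es]; apply/nbhs_ballP; exists e => //= B AB.
  by apply: es; split=> // i j; rewrite !mxE; exact: AB.2.
by move=> q _ pq _; split.
Qed.

(** The extension behind [tmap_on] at [b z] varies with [z] in an uncontrolled way. Since [c z] is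
    the velocity of a curve in [S], the value can be computed instead from the one extension [F]
    chosen at [b z0], whose tangent map is smooth. *)
Lemma smooth_along_tmap_on X Y Z (W : set (pt Z)) (S : set (pt X))
    (f : pt X -> pt Y) (b : pt Z -> pt X) (c : pt Z -> model X) :
  (forall z, cdom Z z z) ->
  atlas X -> atlas Y -> smooth_on S f -> (forall z, W z -> S (b z)) ->
  smooth_along W b c ->
  (forall z, W z -> exists2 g, velocity g (b z) (c z) & forall e, S (g e)) ->
  smooth_along W (f \o b) (fun z => tmap_on S f (b z) (c z)).
Proof.
move=> Zc aX aY sf Sb sbc tgt z0 Wz0.
have [H [U [oU Uz CH HE]]] := sbc z0 Wz0.
have [F FE] := sf (b z0) (Sb z0 Wz0); have [V [oV Vp CF FP]] := FE.
have [oUV CK] := Cinfty_tangent oU oV CH CF.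
exists (fun e => (F (H e).1, 'd F ((H e).1) (H e).2)), (U `&` [set e | V (H e).1]).
split=> //.
- by split=> //=; have [_ <-] := HE z0 Wz0 (Zc z0) Uz.
- move=> q Wq z0q [Uq Vq].
  have [/= bq Hq] := HE q Wq z0q Uq.
  have Vbq : V (chart X (b z0) (b q)) by move: Vq => /=; rewrite -Hq.
  have [fbq FEq] := FP (b q) (Sb q Wq) bq Vbq.
  split=> //=; rewrite -Hq /= -FEq; congr (_, _).
  (* Both sides are derivatives of f o g in the chart at [f (b z0)]: one through the extension at
     [b q] and a change of charts, the other through [F]. *)
  have [g gv Sg] := tgt q Wq.
  have fg := velocity_tmap_on sf gv Sg.
  have [_ dfg] := velocity_chart aY fg fbq.
  have [gp dg] := velocity_chart aX gv bq.
  have dF : differentiable F ((chart X (b z0) \o g) 0).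
    have [g0 _ _] := gv; rewrite /= g0.
    exact: Cinfty_differentiable CF Vbq.
  have dFg := is_derive_comp dg dF.
  have [g0 _ _] := gv; rewrite [X in 'd F X]/= g0 in dFg.
  rewrite -(@derive_val _ _ _ _ _ _ _ dfg) -(@derive_val _ _ _ _ _ _ _ dFg).
  apply: near_eq_derive.
  have gV : \forall e \near (0 : R), V (chart X (b z0) (g e)).
    have cg := is_derive_continuous dg; rewrite /= g0 in cg.
    have nV : nbhs (chart X (b z0) (b q)) V by exact: open_nbhs_nbhs.
    exact: (cg _ nV).
  apply: filterS2 gp gV => e gpe gVe /=.
  by have [_ ->] := FP (g e) (Sg e) gpe gVe.
Qed.

Lemma smooth_along_pair X Y Z (W : set (pt Z)) (b : pt Z -> pt X)
    (b' : pt Z -> pt Y) c c' :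
  atlas X -> atlas Y -> smooth_along W b c -> smooth_along W b' c' ->
  @smooth_along R Z (prodc X Y) W (fun z => (b z, b' z)) (fun z => (c z, c' z)).
Proof.
move=> aX aY sc sc' z0 Wz0.
have [H [U [oU Uz CH HE]]] := sc z0 Wz0.
have [H' [U' [oU' Uz' CH' HE']]] := sc' z0 Wz0.
have CK := Cinfty_pair_tangent oU oU' CH CH'.
exists (fun e => (((H e).1, (H' e).1), ((H e).2, (H' e).2))), (U `&` U').
have oUU' := openI oU oU'; split=> //.
- move=> q Wq z0q [Uq Uq'].
  have [/= bq Hq] := HE q Wq z0q Uq; have [/= bq' Hq'] := HE' q Wq z0q Uq'.
  split=> //=; rewrite -Hq -Hq' /=; congr (_, _).
  have dp := is_diff_prod (atlas_diff aX bq) (atlas_diff aY bq').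
  by have /= -> := @diff_val _ _ _ _ _ _ _ dp.
Qed.

End Velocity.

(** * Linear maps between subquotients *)

Section InducedMap.
Variables (R : realType) (E : lmodType R) (Z B : Defs.subspace E).

Lemma cls_mk z (Zz : Z z) : cls z = sq_mk B Zz.
Proof.
rewrite /cls; case: pselect => [Zz'|/(_ Zz)//].
exact: sq_mk_irr.
Qed.

Lemma clsP (q : subquot Z B) : exists2 z, Z z & q = cls z.
Proof.
exists (sq_rep q); first exact: sq_repP.
by rewrite (cls_mk (sq_repP q)) sq_repK.
Qed.

Lemma cls_eq z w : Z z -> Z w ->
  (cls z = cls w :> subquot Z B) <-> B (z - w).
Proof.
move=> Zz Zw; rewrite (cls_mk Zz) (cls_mk Zw); split; last exact: sq_mkE.
move=> /(congr1 (@coset _ _ _ _)) /= /seteqP[+ _] => /(_ z); apply => /=.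
by rewrite subrr; exact: subspace0.
Qed.

Lemma cls_eq0 z : Z z -> (cls z = 0 :> subquot Z B) <-> B z.
Proof.
move=> Zz; have -> : 0 = cls 0 :> subquot Z B.
  rewrite (cls_mk (subspace0 Z)); exact: sq_mk_irr.
by have := cls_eq Zz (subspace0 Z); rewrite subr0.
Qed.

Lemma cls_lin a z w : Z z -> Z w ->
  cls (a *: z + w) = a *: cls z + cls w :> subquot Z B.
Proof.
move=> Zz Zw; rewrite (cls_mk Zz) (cls_mk Zw) (cls_mk (subspace_lin a Zz Zw)).
rewrite -[RHS]/(sq_add (sq_scale a _) _) sq_scaleE sq_addE; exact: sq_mk_irr.
Qed.

End InducedMap.

(** A linear relation replaces a map on representatives because the connecting map K goes through
    the choice of a lift. Independence of the choice is the third hypothesis applied to the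
    difference of two related pairs. *)
Lemma induced_linear_map (R : realType) (E E' : lmodType R) (Z B : Defs.subspace E)
    (Z' B' : Defs.subspace E') (rel : E -> E' -> Prop) :
  (forall a z w z' w', rel z z' -> rel w w' -> rel (a *: z + w) (a *: z' + w')) ->
  (forall z, Z z -> exists2 z', Z' z' & rel z z') ->
  (forall z z', Z z -> Z' z' -> rel z z' -> B z -> B' z') ->
  exists f : {linear subquot Z B -> subquot Z' B'},
    forall z z', Z z -> Z' z' -> rel z z' -> f (cls z) = cls z'.
Proof.
move=> lrel trel Brel.
have gex z : exists z', Z z -> Z' z' /\ rel z z'.
  have [Zz|nZz] := pselect (Z z); last by exists 0.
  by have [z' Zz' zz'] := trel z Zz; exists z'.
have [g gP] := choice gex.
pose f (q : subquot Z B) : subquot Z' B' := cls (g (sq_rep q)).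
have fE z z' : Z z -> Z' z' -> rel z z' -> f (cls z) = cls z'.
  move=> Zz Zz' zz'; rewrite /f; set w := sq_rep _.
  have Zw : Z w by exact: sq_repP.
  have [Zgw wgw] := gP w Zw; apply/cls_eq => //.
  have ww : cls w = cls z :> subquot Z B.
    by rewrite (cls_mk B (sq_repP (cls z))) sq_repK.
  have Bwz := (cls_eq B Zw Zz).1 ww.
  apply: (Brel (w - z)) => //.
  - by rewrite addrC -scaleN1r; exact: subspace_lin.
  - by rewrite addrC -scaleN1r; exact: subspace_lin.
  - by rewrite addrC -scaleN1r [_ - z']addrC -scaleN1r; exact: lrel.
have lf : linear f.
  move=> a p q; have [z Zz ->] := clsP p; have [w Zw ->] := clsP q.
  have [Zgz zgz] := gP z Zz; have [Zgw wgw] := gP w Zw.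
  rewrite -cls_lin// (fE _ _ Zz Zgz zgz) (fE _ _ Zw Zgw wgw) -cls_lin//.
  by apply: fE; [exact: subspace_lin|exact: subspace_lin|exact: lrel].
pose fM := GRing.isLinear.Build _ _ _ _ _ lf.
pose fL : {linear subquot Z B -> subquot Z' B'} := HB.pack f fM.
by exists fL.
Qed.

(* Otherwise conversion compares differentials by unfolding the charts. *)
#[local] Opaque tmap tmap_on.

(** * Differentials of the groupoid operations *)

Section GroupoidCalculus.
Variables (R : realType) (n m : nat) (Gr : lie_groupoid R n m).
Local Notation G := (arr Gr).
Local Notation M := (obj Gr).
Local Notation s := (@src R n m Gr).
Local Notation t := (@tgt R n m Gr).
Local Notation one := (@gunit R n m Gr).
Local Notation inv := (@ginv R n m Gr).
Local Notation mul := (@gmul R n m Gr).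
Local Notation TG := 'rV[R]_n.
Local Notation TX := 'rV[R]_m.
Local Notation velG := (@velocity R G).
Local Notation velM := (@velocity R M).

Implicit Types (g h k p q r : G) (x : M) (a b u v w : TG).

Let aG : atlas G := atlas_manifold G.
Let aM : atlas M := atlas_manifold M.

(** * Groupoid identities *)

Lemma ginv_unit x : inv (one x) = one x.
Proof.
have := gmul1 (inv (one x)); rewrite src_inv tgt_unit => <-.
by rewrite gmulVl src_unit.
Qed.

Lemma gmulK g h : s g = t h -> mul (mul g h) (inv h) = g.
Proof. by move=> gh; rewrite -gmulA ?tgt_inv// gmulV -gh gmul1. Qed.

Lemma gmulVK g h : s g = s h -> mul (mul g (inv h)) h = g.
Proof. by move=> gh; rewrite -gmulA ?src_inv ?tgt_inv// gmulVl -gh gmul1. Qed.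

Lemma ginv_eq g h : s g = t h -> mul g h = one (t g) -> h = inv g.
Proof.
move=> gh gh1; rewrite -(gmul1l h) -gh -gmulVl -gmulA ?src_inv// gh1.
by rewrite -(src_inv g) gmul1.
Qed.

Lemma ginvM g h : s g = t h -> inv (mul g h) = mul (inv h) (inv g).
Proof.
move=> gh; have e1 : s (inv h) = t (inv g) by rewrite src_inv tgt_inv.
apply/esym/ginv_eq; first by rewrite src_mul// tgt_mul// tgt_inv.
rewrite (tgt_mul gh) gmulA//; last by rewrite src_mul// tgt_inv.
by rewrite gmulK// gmulV.
Qed.

Lemma ginvK g : inv (inv g) = g.
Proof. by apply/esym/ginv_eq; rewrite ?src_inv// gmulVl tgt_inv. Qed.

(** * Curves of arrows and their images under the operations *)

Lemma src_curve g v : ds g v = 0 ->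
  exists2 c, velG c g v & forall e, s (c e) = s g.
Proof. exact: (fibre_curve aG (src_submersion Gr)). Qed.

Lemma tgt_curve g v : dt g v = 0 ->
  exists2 c, velG c g v & forall e, t (c e) = t g.
Proof. exact: (fibre_curve aG (tgt_submersion Gr)). Qed.

Lemma velocity_src c g v : velG c g v -> velM (s \o c) (s g) (ds g v).
Proof. exact: velocity_tmap aG (src_submersion Gr).1. Qed.

Lemma velocity_tgt c g v : velG c g v -> velM (t \o c) (t g) (dt g v).
Proof. exact: velocity_tmap aG (tgt_submersion Gr).1. Qed.

Lemma velocity_inv c g v : velG c g v -> velG (inv \o c) (inv g) (di g v).
Proof. exact: velocity_tmap aG (@ginv_smooth R n m Gr). Qed.

Lemma ds_curve c g v x : velG c g v -> (forall e, s (c e) = x) -> ds g v = 0.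
Proof.
move=> cv sc; have := velocity_src cv; have <- : x = s g.
  by have [<- _ _] := cv; rewrite sc.
have -> : s \o c = (fun=> x) by apply/funext => e; exact: sc.
by move/velocity_unique; apply; exact: velocity_cst.
Qed.

Lemma dt_curve c g v x : velG c g v -> (forall e, t (c e) = x) -> dt g v = 0.
Proof.
move=> cv tc; have := velocity_tgt cv; have <- : x = t g.
  by have [<- _ _] := cv; rewrite tc.
have -> : t \o c = (fun=> x) by apply/funext => e; exact: tc.
by move/velocity_unique; apply; exact: velocity_cst.
Qed.

(** The curve at [p] is arbitrary and its source curve is lifted at [q] and at [r]. The lifts match
    near 0 only, so all three curves are made constant at the bad parameters together. Three of them
    serve [dmbar_dmbar]. *)
Lemma common_source_curves p q r u v w : s p = s q -> s p = s r ->
  ds p u = ds q v -> ds p u = ds r w ->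
  exists a b c : R -> G, [/\ velG a p u, velG b q v, velG c r w &
    forall e, s (a e) = s (b e) /\ s (a e) = s (c e)].
Proof.
move=> pq pr duv duw; have [a au] := @velocity_exists R G p u aG.
have sa := velocity_src au; have sa' := sa.
rewrite pq duv in sa; rewrite pr duw in sa'.
have [b bv ab] := submersion_lift aG (src_submersion Gr) sa.
have [c cw ac] := submersion_lift aG (src_submersion Gr) sa'.
pose good e := `[< s (a e) = s (b e) /\ s (a e) = s (c e) >].
have ngood : \forall e \near (0 : R), good e.
  by apply: filterS2 ab ac => e /= be ce; apply/asboolP.
exists (fun e => if good e then a e else p), (fun e => if good e then b e else q),
  (fun e => if good e then c e else r).
split.
- by apply: velocity_near au; apply: filterS ngood => e ->.
- by apply: velocity_near bv; apply: filterS ngood => e ->.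
- by apply: velocity_near cw; apply: filterS ngood => e ->.
- by move=> e; rewrite /good; case: asboolP.
Qed.

(** Translations are its values on pairs with one zero component, which gives access to its
    additivity and to its smooth dependence on the translating arrow. *)
Definition dmul (g h : G) (v w : TG) : TG :=
  @tmap_on R (prodc G G) G [set z | s z.1 = t z.2] (fun z => mul z.1 z.2)
    (g, h) (v, w).

Lemma velocity_mul c d g h v w : velG c g v -> velG d h w ->
  (forall e, s (c e) = t (d e)) ->
  velG (fun e => mul (c e) (d e)) (mul g h) (dmul g h v w).
Proof.
move=> cv dw cd.
exact: (velocity_comp2 (gmul_smooth (l := Gr)) cv dw cd).
Qed.

Lemma dmbar_smooth : @smooth_on R (prodc G G) G [set z | s z.1 = s z.2]
  (fun z => mul z.1 (inv z.2)).
Proof.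
apply: (@smooth_comp R (prodc G G) (prodc G G) G _ _ (fun z => (z.1, inv z.2)) _
  (atlas_center (atlas_prodc aG aG)) _ _ (gmul_smooth (l := Gr))).
  by move=> a /= e; rewrite tgt_inv.
apply: smooth_on_pair; first by apply: smooth_sub (@smooth_fst R G G).
apply: (@smooth_comp R (prodc G G) G G _ setT snd inv
  (atlas_center (atlas_prodc aG aG))) => //.
  by apply: smooth_sub (@smooth_snd R G G).
exact: ginv_smooth.
Qed.

Lemma rtr_smooth g : @smooth_on R G G [set k | s k = t g] (fun k => mul k g).
Proof.
apply: (@smooth_comp R G (prodc G G) G _ _ (fun k => (k, g)) _
  (atlas_center aG) _ _ (gmul_smooth (l := Gr))) => //.
apply: smooth_on_pair; first by apply: smooth_sub (@smooth_id R G).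
by apply: smooth_sub (@smooth_cst R G G g aG).
Qed.

Lemma ltr_smooth g : @smooth_on R G G [set k | t k = s g] (fun k => mul g k).
Proof.
apply: (@smooth_comp R G (prodc G G) G _ _ (fun k => (g, k)) _
  (atlas_center aG) _ _ (gmul_smooth (l := Gr))) => //.
apply: smooth_on_pair; first by apply: smooth_sub (@smooth_cst R G G g aG).
by apply: smooth_sub (@smooth_id R G).
Qed.

Lemma velocity_rtr c g h v : velG c h v -> (forall e, s (c e) = t g) ->
  velG (fun e => mul (c e) g) (mul h g) (rtr g h v).
Proof. by move=> cv sc; exact: (velocity_tmap_on (@rtr_smooth g) cv sc). Qed.

Lemma velocity_ltr c g h v : velG c h v -> (forall e, t (c e) = s g) ->
  velG (fun e => mul g (c e)) (mul g h) (ltr g h v).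
Proof. by move=> cv tc; exact: (velocity_tmap_on (@ltr_smooth g) cv tc). Qed.

Lemma velocity_dmbar c d p q v w : velG c p v -> velG d q w ->
  (forall e, s (c e) = s (d e)) ->
  velG (fun e => mul (c e) (inv (d e))) (mul p (inv q)) (dmbar p q v w).
Proof.
by move=> cv dw cd; exact: (velocity_comp2 dmbar_smooth cv dw cd).
Qed.

Lemma dsD g v w : ds g (v + w) = ds g v + ds g w.
Proof. by rewrite -[v]scale1r ds_linear !scale1r. Qed.

Lemma dtD g v w : dt g (v + w) = dt g v + dt g w.
Proof. by rewrite -[v]scale1r dt_linear !scale1r. Qed.

Lemma dsN g v : ds g (- v) = - ds g v.
Proof.
rewrite -scaleN1r -[_ *: v]addr0 ds_linear.
by rewrite (linear_0 (@ds_linear _ _ _ Gr g)) addr0 scaleN1r.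
Qed.

Lemma dtN g v : dt g (- v) = - dt g v.
Proof.
rewrite -scaleN1r -[_ *: v]addr0 dt_linear.
by rewrite (linear_0 (@dt_linear _ _ _ Gr g)) addr0 scaleN1r.
Qed.

Lemma ds0 g : ds g 0 = 0. Proof. exact/linear_0/ds_linear. Qed.
Lemma dt0 g : dt g 0 = 0. Proof. exact/linear_0/dt_linear. Qed.
Lemma rtr0 g h : rtr g h 0 = 0. Proof. exact/linear_0/rtr_linear. Qed.
Lemma ltr0 g h : ltr g h 0 = 0. Proof. exact/linear_0/ltr_linear. Qed.

Lemma ltrN g h v : ltr g h (- v) = - ltr g h v.
Proof. by rewrite -scaleN1r -[_ *: v]addr0 ltr_linear ltr0 addr0 scaleN1r. Qed.

Lemma dmbarD p q v w v' w' :
  dmbar p q (v + v') (w + w') = dmbar p q v w + dmbar p q v' w'.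
Proof.
have := @tmap_on_linear2 R n m Gr [set z | s z.1 = s z.2]
  (fun z => mul z.1 (inv z.2)) (p, q) 1 v v' w w'.
by rewrite !scale1r.
Qed.

Lemma dmulD g h v w v' w' :
  dmul g h (v + v') (w + w') = dmul g h v w + dmul g h v' w'.
Proof.
have := @tmap_on_linear2 R n m Gr [set z | s z.1 = t z.2]
  (fun z => mul z.1 z.2) (g, h) 1 v v' w w'.
by rewrite !scale1r.
Qed.

(** * Translations, division and the isotropy action on tangent vectors *)

Lemma ds_rtr g h v : s h = t g -> ds h v = 0 -> ds (mul h g) (rtr g h v) = 0.
Proof.
move=> hg dv; have [c cv sc] := src_curve dv; rewrite hg in sc.
by apply: (ds_curve (velocity_rtr cv sc) (x := s g)) => e; rewrite src_mul.
Qed.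

Lemma dt_rtr g h v : s h = t g -> ds h v = 0 ->
  dt (mul h g) (rtr g h v) = dt h v.
Proof.
move=> hg dv; have [c cv sc] := src_curve dv; rewrite hg in sc.
apply: velocity_unique (velocity_tgt (velocity_rtr cv sc)) _.
by apply: (velocity_eq (velocity_tgt cv)) => [e|] /=; rewrite tgt_mul.
Qed.

Lemma ds_ltr g h v : t h = s g -> dt h v = 0 ->
  ds (mul g h) (ltr g h v) = ds h v.
Proof.
move=> hg dv; have [c cv tc] := tgt_curve dv; rewrite hg in tc.
apply: velocity_unique (velocity_src (velocity_ltr cv tc)) _.
by apply: (velocity_eq (velocity_src cv)) => [e|] /=; rewrite src_mul.
Qed.

Lemma dt_ltr g h v : t h = s g -> dt h v = 0 -> dt (mul g h) (ltr g h v) = 0.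
Proof.
move=> hg dv; have [c cv tc] := tgt_curve dv; rewrite hg in tc.
by apply: (dt_curve (velocity_ltr cv tc) (x := t g)) => e; rewrite tgt_mul.
Qed.

Lemma rtr_rtr g k h v : s h = t g -> s g = t k -> ds h v = 0 ->
  rtr k (mul h g) (rtr g h v) = rtr (mul g k) h v.
Proof.
move=> hg gk dv; have [c cv sc] := src_curve dv; rewrite hg in sc.
have cgv := velocity_rtr cv sc.
have scg e : s (mul (c e) g) = t k by rewrite src_mul.
have sc' e : s (c e) = t (mul g k) by rewrite sc tgt_mul.
apply: velocity_unique (velocity_rtr cgv scg) _.
by apply: (velocity_eq (velocity_rtr cv sc')) => [e|]; rewrite gmulA.
Qed.

Lemma rtr_unit h x v : s h = x -> ds h v = 0 -> rtr (one x) h v = v.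
Proof.
move=> <- dv; have [c cv sc] := src_curve dv.
have sc' e : s (c e) = t (one (s h)) by rewrite tgt_unit.
have := velocity_rtr cv sc'; rewrite gmul1 => rv.
apply: velocity_unique rv _; apply: (velocity_eq cv) => [e|//].
by rewrite -(sc e) gmul1.
Qed.

Lemma rtrK g v : ds (one (t g)) v = 0 ->
  rtr (inv g) g (rtr g (one (t g)) v) = v.
Proof.
move=> dv; rewrite -{2}(gmul1l g) rtr_rtr ?src_unit ?tgt_inv// gmulV.
by rewrite rtr_unit// src_unit.
Qed.

Lemma rtrVK g w : ds g w = 0 ->
  rtr g (one (t g)) (rtr (inv g) g w) = w.
Proof.
move=> dw; rewrite -gmulV rtr_rtr ?tgt_inv ?src_inv// gmulVl.
by rewrite rtr_unit.
Qed.

Lemma ds_rtrV g w : ds g w = 0 -> ds (one (t g)) (rtr (inv g) g w) = 0.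
Proof. by move=> dw; rewrite -gmulV ds_rtr ?tgt_inv. Qed.

Lemma dt_rtrV g w : ds g w = 0 -> dt (one (t g)) (rtr (inv g) g w) = dt g w.
Proof. by move=> dw; rewrite -gmulV dt_rtr ?tgt_inv. Qed.

Lemma ds_dmbar p q v w : s p = s q -> ds p v = ds q w ->
  ds (mul p (inv q)) (dmbar p q v w) = dt q w.
Proof.
move=> pq dvw; have [a [b [c [av bw _ ab]]]] := common_source_curves pq pq dvw dvw.
have ab' e : s (a e) = s (b e) by case: (ab e).
apply: velocity_unique (velocity_src (velocity_dmbar av bw ab')) _.
by apply: (velocity_eq (velocity_tgt bw)) => [e|] /=;
  rewrite src_mul ?src_inv ?tgt_inv.
Qed.

Lemma dt_dmbar p q v w : s p = s q -> ds p v = ds q w ->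
  dt (mul p (inv q)) (dmbar p q v w) = dt p v.
Proof.
move=> pq dvw; have [a [b [c [av bw _ ab]]]] := common_source_curves pq pq dvw dvw.
have ab' e : s (a e) = s (b e) by case: (ab e).
apply: velocity_unique (velocity_tgt (velocity_dmbar av bw ab')) _.
by apply: (velocity_eq (velocity_tgt av)) => [e|] /=; rewrite tgt_mul ?tgt_inv.
Qed.

(** Differentiates (p r^-1)(q r^-1)^-1 = p q^-1 along curves with a common source. This is the
    identity behind the vanishing of the square of [delta]. *)
Lemma dmbar_dmbar p q r u v w : s p = s q -> s p = s r ->
  ds p u = ds q v -> ds p u = ds r w ->
  dmbar (mul p (inv r)) (mul q (inv r)) (dmbar p r u w) (dmbar q r v w) =
  dmbar p q u v.
Proof.
move=> pq pr duv duw.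
have [a [b [c [au bv cw abc]]]] := common_source_curves pq pr duv duw.
have ac e : s (a e) = s (c e) by case: (abc e).
have ab e : s (a e) = s (b e) by case: (abc e).
have bc e : s (b e) = s (c e) by rewrite -ab ac.
have acb e : s (mul (a e) (inv (c e))) = s (mul (b e) (inv (c e))).
  by rewrite !src_mul ?tgt_inv.
have qr : s q = s r by rewrite -pq.
have E g h k : s g = s k -> s h = s k ->
    mul (mul g (inv k)) (inv (mul h (inv k))) = mul g (inv h).
  move=> gk hk; rewrite ginvM ?tgt_inv// ginvK gmulA ?src_mul ?tgt_inv//.
  - by rewrite gmulVK.
  - by rewrite src_inv.
apply: velocity_unique
  (velocity_dmbar (velocity_dmbar au cw ac) (velocity_dmbar bv cw bc) acb) _.
by apply: (velocity_eq (velocity_dmbar au bv ab)) => [e|]; rewrite E.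
Qed.

(* Along a curve c in an s-fibre through 1_x, c c^-1 consists of units, so its
   velocity a + di a vanishes when the velocity of t c does. *)
Lemma di_isotropy x a : isotropy x a -> di (one x) a = - a.
Proof.
move=> [dsa dta]; have [c ca sc] := src_curve dsa; rewrite src_unit in sc.
have icv := velocity_inv ca; rewrite ginv_unit in icv.
have ci e : s (c e) = t ((inv \o c) e) by rewrite /= tgt_inv.
have m11 : mul (one x) (one x) = one x by rewrite -{1}(tgt_unit x) gmul1l.
have dl : dmul (one x) (one x) a 0 = a.
  have c1 e : s (c e) = t (one x) by rewrite sc tgt_unit.
  apply: velocity_unique (velocity_mul ca (velocity_cst (one x : pt G) aG) c1) _.
  by apply: (velocity_eq ca) => [e|//]; rewrite -(sc e) gmul1.
have dr : dmul (one x) (one x) 0 (di (one x) a) = di (one x) a.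
  have c1 e : s (one x) = t ((inv \o c) e) by rewrite /= src_unit tgt_inv sc.
  apply: velocity_unique (velocity_mul (velocity_cst (one x : pt G) aG) icv c1) _.
  by apply: (velocity_eq icv) => [e|//]; rewrite /= -(sc e) -tgt_inv gmul1l.
have sum0 : dmul (one x) (one x) a (di (one x) a) = 0.
  apply: velocity_unique (velocity_mul ca icv ci) _.
  have := velocity_tmap aM (@unit_smooth R n m Gr) (velocity_tgt ca).
  rewrite -/(dt _ _) dta (linear_0 (@tmap_linear _ _ _ _ _)) => uv.
  by apply: (velocity_eq uv) => [e|] /=; rewrite ?gmulV ?tgt_unit.
(* The pair (a, di a) is split as (a, 0) + (0, di a), on which the product reduces to multiplication
   by a unit. *)
have := dmulD (one x) (one x) a 0 0 (di (one x) a).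
rewrite addr0 add0r dl dr sum0 addrC => /esym/eqP.
by rewrite addr_eq0 => /eqP.
Qed.

Lemma dt_di g v : dt (inv g) (di g v) = ds g v.
Proof.
have [c cv] := @velocity_exists R G g v aG.
apply: velocity_unique (velocity_tgt (velocity_inv cv)) _.
by apply: (velocity_eq (velocity_src cv)) => [e|] /=; rewrite tgt_inv.
Qed.

Lemma ds_di g v : ds (inv g) (di g v) = dt g v.
Proof.
have [c cv] := @velocity_exists R G g v aG.
apply: velocity_unique (velocity_src (velocity_inv cv)) _.
by apply: (velocity_eq (velocity_tgt cv)) => [e|] /=; rewrite src_inv.
Qed.

(** Differentiates (c (g h)) h^-1 = c g along a curve c in the s-fibre of a unit. *)
Lemma dmbar_rtr_l g h a : s g = t h -> ds (one (t g)) a = 0 ->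
  dmbar (mul g h) h (rtr (mul g h) (one (t g)) a) 0 = rtr g (one (t g)) a.
Proof.
move=> gh da; have [c ca sc] := src_curve da; rewrite src_unit in sc.
have sc1 e : s (c e) = t (mul g h) by rewrite tgt_mul.
have rv : velG (fun e => mul (c e) (mul g h)) (mul g h)
    (rtr (mul g h) (one (t g)) a).
  apply: (velocity_eq (velocity_rtr ca sc1)) => [//|].
  by rewrite -(tgt_mul gh) gmul1l.
have ce e : s (mul (c e) (mul g h)) = s h by rewrite !src_mul.
apply: velocity_unique (velocity_dmbar rv (velocity_cst (h : pt G) aG) ce) _.
apply: (velocity_eq (velocity_rtr ca sc)) => [e|]; rewrite ?gmul1l ?gmulK//.
by rewrite gmulA ?gmulK ?src_mul.
Qed.

(** Differentiates (g h)(c h)^-1 = g c^-1; the inverse of c is the source of [di]. *)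
Lemma dmbar_rtr_r g h a : s g = t h -> ds (one (t h)) a = 0 ->
  dmbar (mul g h) h 0 (rtr h (one (t h)) a) = ltr g (one (s g)) (di (one (t h)) a).
Proof.
move=> gh da; have [c ca sc] := src_curve da; rewrite src_unit in sc.
have rv : velG (fun e => mul (c e) h) h (rtr h (one (t h)) a).
  by apply: (velocity_eq (velocity_rtr ca sc)) => [//|]; rewrite gmul1l.
have ce e : s (mul g h) = s (mul (c e) h) by rewrite !src_mul.
apply: velocity_unique (velocity_dmbar (velocity_cst (mul g h : pt G) aG) rv ce) _.
have tic e : t ((inv \o c) e) = s g by rewrite /= tgt_inv sc.
have iv : velG (inv \o c) (one (s g)) (di (one (t h)) a).
  apply: (velocity_eq (velocity_inv ca)) => [//|].
  by rewrite ginv_unit gh.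
apply: (velocity_eq (velocity_ltr iv tic)) => [e|]; last first.
  by rewrite gmul1 gmulK.
by rewrite /= ginvM ?sc// gmulA ?gmulK ?src_mul ?src_inv ?tgt_inv ?sc.
Qed.

(** Along a curve c in a t-fibre, (g h c)(h c)^-1 is the constant g. *)
Lemma dmbar_ltr g h b : s g = t h -> dt (one (s h)) b = 0 ->
  dmbar (mul g h) h (ltr (mul g h) (one (s h)) b) (ltr h (one (s h)) b) = 0.
Proof.
move=> gh db; have [c cb tc] := tgt_curve db; rewrite tgt_unit in tc.
have tc' e : t (c e) = s (mul g h) by rewrite src_mul.
have lv : velG (fun e => mul h (c e)) h (ltr h (one (s h)) b).
  by apply: (velocity_eq (velocity_ltr cb tc)) => [//|]; rewrite gmul1.
have lv' : velG (fun e => mul (mul g h) (c e)) (mul g h)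
    (ltr (mul g h) (one (s h)) b).
  apply: (velocity_eq (velocity_ltr cb tc')) => [//|].
  by rewrite -(src_mul gh) gmul1.
have ce e : s (mul (mul g h) (c e)) = s (mul h (c e)) by rewrite !src_mul.
apply: velocity_unique (velocity_dmbar lv' lv ce) _.
apply: (velocity_eq (velocity_cst (g : pt G) aG)) => [e|]; last by rewrite gmulK.
by rewrite -[mul (mul g h) _]gmulA// gmulK// tgt_mul.
Qed.

Lemma isotropy_Ad g b : isotropy (s g) b -> isotropy (t g) (Ad g b).
Proof.
move=> [dsb dtb].
have l0 : ds g (ltr g (one (s g)) b) = 0.
  by have := ds_ltr (tgt_unit (s g)) dtb; rewrite gmul1 dsb.
split; first exact: ds_rtrV l0.
rewrite /Ad (dt_rtrV l0).
by have := dt_ltr (tgt_unit (s g)) dtb; rewrite gmul1.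
Qed.

Lemma rtr_Ad g b : isotropy (s g) b ->
  rtr g (one (t g)) (Ad g b) = ltr g (one (s g)) b.
Proof.
move=> [dsb dtb]; apply: rtrVK.
by have := ds_ltr (tgt_unit (s g)) dtb; rewrite gmul1 dsb.
Qed.

(** Additivity separates [a] from [b]. The second part is l_g di(b) = - l_g b = - r_g (Ad_g b). With
    the minus sign in front of the division term, these are the first two terms of the isotropy
    differential. *)
Lemma dmbar_isotropy g h a b : s g = t h ->
  isotropy (t g) a -> isotropy (t h) b ->
  dmbar (mul g h) h (rtr (mul g h) (one (t (mul g h))) a) (rtr h (one (t h)) b) =
  rtr g (one (t g)) a - rtr g (one (t g)) (Ad g b).
Proof.
move=> gh [dsa dta] ib; have [dsb dtb] := ib.
rewrite -[X in dmbar _ _ X _]addr0 -[X in dmbar _ _ _ X]add0r dmbarD.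
rewrite tgt_mul// dmbar_rtr_l// dmbar_rtr_r// di_isotropy//.
by rewrite rtr_Ad ?gh// ltrN.
Qed.

End GroupoidCalculus.

(** * Cochains *)

Section Cochains.
Variables (R : realType) (n m : nat) (Gr : lie_groupoid R n m).
Local Notation G := (arr Gr).
Local Notation M := (obj Gr).
Local Notation s := (@src R n m Gr).
Local Notation t := (@tgt R n m Gr).
Local Notation one := (@gunit R n m Gr).
Local Notation inv := (@ginv R n m Gr).
Local Notation mul := (@gmul R n m Gr).
Local Notation TG := 'rV[R]_n.
Local Notation TX := 'rV[R]_m.
Implicit Types (x : M) (Z : charted R).

Let aG : atlas G := atlas_manifold G.
Let aM : atlas M := atlas_manifold M.

Lemma smooth_along_eq X Z (W : set (pt Z)) (b b' : pt Z -> pt X) c c' :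
  (forall z, W z -> b z = b' z) -> (forall z, W z -> c z = c' z) ->
  smooth_along W b c -> smooth_along W b' c'.
Proof. by move=> bb cc; apply: smooth_on_eq => z Wz; rewrite bb ?cc. Qed.

(** Here the translated map itself varies with z, so [rtr] is first rewritten as the fixed map
    [dmul] at (h z, g z) on the vector (v z, 0). *)
Lemma smooth_along_rtr Z (W : set (pt Z)) (h g : pt Z -> G) (v : pt Z -> TG) :
  (forall z, cdom Z z z) -> @smooth_along R Z G W h v -> @smooth_on R Z G W g ->
  (forall z, W z -> s (h z) = t (g z)) ->
  (forall z, W z -> ds (h z) (v z) = 0) ->
  @smooth_along R Z G W (fun z => mul (h z) (g z))
    (fun z => rtr (g z) (h z) (v z)).
Proof.
move=> Zc sv sg hg dv.
have svg := smooth_along_pair aG aG sv (smooth_along0 sg).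
have curve z : W z -> exists2 c, @velocity R (prodc G G) c (h z, g z) (v z, 0) &
    forall e, [set z | s z.1 = t z.2] (c e).
  move=> Wz; have [c cv sc] := src_curve (dv z Wz).
  exists (fun e => (c e, g z)); last by move=> e; rewrite /= sc hg.
  exact: velocity_pair cv (velocity_cst (g z : pt G) aG).
have hg' z : W z -> [set z | s z.1 = t z.2] (h z, g z) := @hg z.
have := smooth_along_tmap_on Zc (atlas_prodc aG aG) aG (gmul_smooth (l := Gr))
  hg' svg curve.
apply: smooth_along_eq => // z Wz.
have [c cv sc] := src_curve (dv z Wz).
have sc' e : s (c e) = t (g z) by rewrite sc hg.
apply: velocity_unique
  (velocity_mul cv (velocity_cst (g z : pt G) aG) sc') (velocity_rtr cv sc').
Qed.

Lemma smooth_along_ltr Z (W : set (pt Z)) (h g : pt Z -> G) (v : pt Z -> TG) :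
  (forall z, cdom Z z z) -> @smooth_along R Z G W h v -> @smooth_on R Z G W g ->
  (forall z, W z -> s (g z) = t (h z)) ->
  (forall z, W z -> dt (h z) (v z) = 0) ->
  @smooth_along R Z G W (fun z => mul (g z) (h z))
    (fun z => ltr (g z) (h z) (v z)).
Proof.
move=> Zc sv sg hg dv.
have svg := smooth_along_pair aG aG (smooth_along0 sg) sv.
have curve z : W z -> exists2 c, @velocity R (prodc G G) c (g z, h z) (0, v z) &
    forall e, [set z | s z.1 = t z.2] (c e).
  move=> Wz; have [c cv sc] := tgt_curve (dv z Wz).
  exists (fun e => (g z, c e)); last by move=> e; rewrite /= sc hg.
  exact: velocity_pair (velocity_cst (g z : pt G) aG) cv.
have hg' z : W z -> [set z | s z.1 = t z.2] (g z, h z) := @hg z.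
have := smooth_along_tmap_on Zc (atlas_prodc aG aG) aG (gmul_smooth (l := Gr))
  hg' svg curve.
apply: smooth_along_eq => // z Wz.
have [c cv sc] := tgt_curve (dv z Wz).
have sc' e : t (c e) = s (g z) by rewrite sc hg.
have sc'' e : s (g z) = t (c e) by rewrite sc'.
apply: velocity_unique
  (velocity_mul (velocity_cst (g z : pt G) aG) cv sc'') (velocity_ltr cv sc').
Qed.

Lemma smooth_along_dmbar Z (W : set (pt Z)) (p q : pt Z -> G)
    (v w : pt Z -> TG) :
  (forall z, cdom Z z z) ->
  @smooth_along R Z G W p v -> @smooth_along R Z G W q w ->
  (forall z, W z -> s (p z) = s (q z)) ->
  (forall z, W z -> ds (p z) (v z) = ds (q z) (w z)) ->
  @smooth_along R Z G W (fun z => mul (p z) (inv (q z)))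
    (fun z => dmbar (p z) (q z) (v z) (w z)).
Proof.
move=> Zc sv sw pq dvw.
have svw := smooth_along_pair aG aG sv sw.
have curve z : W z -> exists2 c, @velocity R (prodc G G) c (p z, q z) (v z, w z) &
    forall e, [set z | s z.1 = s z.2] (c e).
  move=> Wz; have [a [b [c [av bw _ ab]]]] :=
    common_source_curves (pq z Wz) (pq z Wz) (dvw z Wz) (dvw z Wz).
  exists (fun e => (a e, b e)); last by move=> e; case: (ab e).
  exact: velocity_pair av bw.
have pq' z : W z -> [set z | s z.1 = s z.2] (p z, q z) := @pq z.
exact: (smooth_along_tmap_on Zc (atlas_prodc aG aG) aG (dmbar_smooth (Gr := Gr))
  pq' svw curve).
Qed.

Lemma smooth_along_tmap X Y Z (W : set (pt Z)) (f : pt X -> pt Y) b c :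
  (forall z, cdom Z z z) -> atlas X -> atlas Y -> smooth f ->
  @smooth_along R Z X W b c ->
  @smooth_along R Z Y W (f \o b) (fun z => tmap f (b z) (c z)).
Proof.
move=> Zc aX aY sf sc.
have curve z : W z ->
    exists2 g, velocity g (b z) (c z) & forall e, [set: pt X] (g e).
  by move=> _; have [g gv] := velocity_exists (b z) (c z) aX; exists g.
have bT z : W z -> [set: pt X] (b z) by [].
have := smooth_along_tmap_on Zc aX aY sf bT sc curve.
by apply: smooth_along_eq => [//|z _]; exact: tmap_onT.
Qed.

(** * The vector fields on the arrows defined by a section of A *)

Section Arrows.
Implicit Types (g h : G) (a : M -> TG).

Lemma smooth_rarrow a : is_section a -> @vector_field R G (rarrow a).
Proof.
move=> [sa dsa].
have sat : @smooth_along R G G setT (one \o t) (a \o t).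
  exact: (@smooth_comp R G M (TM G) setT setT t (fun x => (one x, a x))
    (atlas_center aG) (fun _ _ => I) (tgt_submersion Gr).1 sa).
have st g : [set: G] g -> s ((one \o t) g) = t g by move=> _; exact: src_unit.
have dst g : [set: G] g -> ds ((one \o t) g) ((a \o t) g) = 0.
  by move=> _; exact: dsa.
have := smooth_along_rtr (atlas_center aG) sat (@smooth_id R G) st dst.
by apply: smooth_along_eq => // g _ /=; rewrite gmul1l.
Qed.

(** Inversion exchanges source and target, so it sends s-vertical vectors to t-vertical ones; left
    translation of [di] of a section is thus meaningful. *)
Lemma dt_di_section a x : is_section a -> dt (one x) (di (one x) (a x)) = 0.
Proof. by move=> [_ dsa]; rewrite -{1}ginv_unit dt_di. Qed.

Lemma smooth_larrow a : is_section a -> @vector_field R G (larrow a).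
Proof.
move=> sa; have [saa _] := sa.
have sas : @smooth_along R G G setT (one \o s) (a \o s).
  exact: (@smooth_comp R G M (TM G) setT setT s (fun x => (one x, a x))
    (atlas_center aG) (fun _ _ => I) (src_submersion Gr).1 saa).
have sdi := smooth_along_tmap (atlas_center aG) aG aG (@ginv_smooth R n m Gr) sas.
have sdi' : @smooth_along R G G setT (one \o s)
    (fun g => di (one (s g)) (a (s g))).
  by apply: smooth_along_eq sdi => // g _ /=; rewrite ginv_unit.
have st g : [set: G] g -> s g = t ((one \o s) g) by move=> _; rewrite /= tgt_unit.
have dst g : [set: G] g -> dt ((one \o s) g) (di (one (s g)) (a (s g))) = 0.
  by move=> _; exact: dt_di_section.
have := smooth_along_ltr (atlas_center aG) sdi' (@smooth_id R G) st dst.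
by apply: smooth_along_eq => // g _ /=; rewrite gmul1.
Qed.

Lemma ds_rarrow a g : is_section a -> ds g (rarrow a g) = 0.
Proof.
by move=> [_ dsa]; have := ds_rtr (src_unit (t g)) (dsa (t g)); rewrite gmul1l.
Qed.

Lemma dt_rarrow a g : is_section a -> dt g (rarrow a g) = rho a (t g).
Proof.
by move=> [_ dsa]; have := dt_rtr (src_unit (t g)) (dsa (t g)); rewrite gmul1l.
Qed.

Lemma ds_larrow a g : is_section a -> ds g (larrow a g) = rho a (s g).
Proof.
move=> sa; have := ds_ltr (tgt_unit (s g)) (dt_di_section (s g) sa).
rewrite gmul1 => ->.
by have := ds_di (one (s g)) (a (s g)); rewrite ginv_unit.
Qed.

Lemma dt_larrow a g : is_section a -> dt g (larrow a g) = 0.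
Proof.
move=> sa; have := dt_ltr (tgt_unit (s g)) (dt_di_section (s g) sa).
by rewrite gmul1.
Qed.

Lemma smooth_rho a : is_section a -> @vector_field R M (rho a).
Proof.
move=> [sa _].
have := smooth_along_tmap (atlas_center aM) aG aM (tgt_submersion Gr).1 sa.
by apply: smooth_along_eq => // x _ /=; rewrite tgt_unit.
Qed.

Definition arrows_vf (a : M -> TG) (g : G) : TG := rarrow a g + larrow a g.

Lemma vector_fieldD (X Y : G -> TG) : @vector_field R G X ->
  @vector_field R G Y -> @vector_field R G (fun g => X g + Y g).
Proof.
move=> sX sY; have := smooth_along_lin 1 sX sY.
by apply: smooth_along_eq => // g _; rewrite scale1r.
Qed.

Lemma lift_arrows_vf a : is_section a -> is_lift (rho a) (arrows_vf a).
Proof.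
move=> sa; split=> [||g|g].
- exact: smooth_rho.
- exact: vector_fieldD (smooth_rarrow sa) (smooth_larrow sa).
- by rewrite dsD ds_rarrow// ds_larrow// add0r.
- by rewrite dtD dt_rarrow// dt_larrow// addr0.
Qed.

(** * Faces of composable strings, and [delta] in degree one *)

Lemma ginit0 k (g : 'I_k.+2 -> G) : ginit g ord0 = g ord0.
Proof. by congr g; exact: val_inj. Qed.

Lemma gmerge0 k (g : 'I_k.+2 -> G) :
  gmerge 0 g ord0 = mul (g ord0) (gtail g ord0).
Proof. by rewrite /gmerge /= ginit0. Qed.

Lemma gmergeS0 k i (g : 'I_k.+2 -> G) : gmerge i.+1 g ord0 = g ord0.
Proof. by rewrite /gmerge /= ginit0. Qed.

Lemma composable_head k (g : 'I_k.+2 -> G) : composable g ->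
  s (g ord0) = t (gtail g ord0).
Proof. exact. Qed.

Lemma composable_tail k (g : 'I_k.+1 -> G) : composable g -> composable (gtail g).
Proof. by move=> cg i j ij; apply: cg; rewrite /= /bump /= !add1n ij. Qed.

Lemma composable_init k (g : 'I_k.+1 -> G) : composable g -> composable (ginit g).
Proof. by move=> cg i j ij; apply: cg. Qed.

Lemma composable_merge k i (g : 'I_k.+2 -> G) : composable g ->
  composable (gmerge i g).
Proof.
move=> cg; have ci := composable_init cg; have ct := composable_tail cg.
have mid (j : 'I_k.+1) : s (ginit g j) = t (gtail g j).
  by apply: cg; rewrite /= /bump /= add1n.
move=> j l jl; rewrite /gmerge jl.
(* Either both neighbours lie before the product; or the left one is the product or both lie after
   it; or the right one is the product. *)
have [li|il|li] := ltngtP j.+1 i.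
- exact: ci.
- have [ji|ji] := eqVneq (j : nat) i; last exact: ct.
  by rewrite src_mul//; exact: ct.
- by rewrite tgt_mul//; exact: ci.
Qed.

Lemma composable1 (g : 'I_1 -> G) : composable g.
Proof. by move=> i j; rewrite !ord1. Qed.

Lemma cochain0E (c : cochain Gr 0) : c = cochain_of_vf (fun g => c (fun=> g)).
Proof.
apply/funext => g; rewrite /cochain_of_vf; congr c.
by apply/funext => i; rewrite ord1.
Qed.

Lemma delta_vf (X : G -> TG) (g : 'I_2 -> G) : composable g ->
  delta (cochain_of_vf X) g = X (g ord0) -
    dmbar (mul (g ord0) (gtail g ord0)) (gtail g ord0)
      (X (mul (g ord0) (gtail g ord0))) (X (gtail g ord0)).
Proof.
move=> cg; rewrite /delta asboolT// big_geq// addr0 /cochain_of_vf gmerge0 ginit0.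
by rewrite sqrrN expr1n scale1r addrC.
Qed.

Definition pair_string (g h : G) : 'I_2 -> G := fun i => if i == ord0 then g else h.

Lemma composable_pair g h : s g = t h -> composable (pair_string g h).
Proof.
move=> gh i j ij; have i0 : i = ord0.
  by apply: val_inj; have := ltn_ord j; rewrite ij !ltnS leqn0 => /eqP.
have j1 : j != ord0 by rewrite -(inj_eq val_inj) /= ij.
by rewrite /pair_string i0 (negbTE j1).
Qed.

(** The right-hand side is multiplicativity of [X] in its division form, g = (g h) h^-1. *)
Lemma delta_vf0 (X : G -> TG) : delta (cochain_of_vf X) = 0 <->
  forall g h, s g = t h -> X g = dmbar (mul g h) h (X (mul g h)) (X h).
Proof.
split=> [dX g h gh|HX].
  have := delta_vf X (composable_pair gh); rewrite dX => /esym/eqP.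
  by rewrite subr_eq0 => /eqP.
apply/funext => g; have [cg|ncg] := pselect (composable g).
  by rewrite delta_vf// -HX ?subrr//; exact: composable_head.
by rewrite /delta asboolF.
Qed.

(** In the division of the field at g h by the field at h, the right-invariant part at g h gives
    back the right-invariant part at g, the right-invariant part at h gives the left-invariant part
    at g since t h = s g, and the left-invariant parts cancel. *)
Lemma delta_delta_0 a : is_section a -> delta (delta_0 a) = 0.
Proof.
move=> sa; apply/(delta_vf0 (arrows_vf a)) => g h gh; have [_ dsa] := sa.
rewrite /arrows_vf /rarrow /larrow (tgt_mul gh) (src_mul gh).
set ga := rtr (mul g h) _ _; set ha := rtr h _ _.
rewrite -[ga]addr0 -[ha]add0r 2!dmbarD.
rewrite /ga /ha (dmbar_rtr_l gh (dsa _)) (dmbar_rtr_r gh (dsa _)).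
rewrite (dmbar_ltr gh (dt_di_section _ sa)).
by rewrite addr0 gh.
Qed.

End Arrows.

Implicit Types (a : M -> TG).

Lemma powc_center k (z : pt (powc k G)) : cdom (powc k G) z z.
Proof. by move=> i; exact: mcdom_center. Qed.

Lemma smooth_along_vf k (W : set ('I_k -> G)) (b : ('I_k -> G) -> G)
    (X : G -> TG) :
  @smooth_on R (powc k G) G W b -> @vector_field R G X ->
  @smooth_along R (powc k G) G W b (X \o b).
Proof.
move=> sb sX; exact: (@smooth_comp R (powc k G) G (TM G) W setT b
  (fun g => (g, X g)) (@powc_center k) (fun _ _ => I) sb sX).
Qed.

Lemma smooth_mul k (W : set ('I_k -> G)) (b c : ('I_k -> G) -> G) :
  @smooth_on R (powc k G) G W b -> @smooth_on R (powc k G) G W c ->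
  (forall z, W z -> s (b z) = t (c z)) ->
  @smooth_on R (powc k G) G W (fun z => mul (b z) (c z)).
Proof.
move=> sb sc bc; exact: (@smooth_comp R (powc k G) (prodc G G) G W _
  (fun z => (b z, c z)) _ (@powc_center k) bc (smooth_on_pair sb sc)
  (gmul_smooth (l := Gr))).
Qed.

(** In degree one the tail of a string is empty, and the condition on [ds] becomes s-projectability.
    Smoothness passes between the first power of the arrows and the arrows by the diagonal and the
    coordinate. *)
Lemma def_cochain_vf (X : G -> TG) :
  is_def_cochain (cochain_of_vf X : cochain Gr 0) <->
  @vector_field R G X /\ forall g h : G, s g = s h -> ds g (X g) = ds h (X h).
Proof.
split=> [[_ sX pX]|[sX pX]].
  split=> [|g h gh].
    have sd : @smooth_on R G (powc 1 G) setT (fun g _ => g) :=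
      @smooth_diagonal R n 1 G.
    have := @smooth_comp R G (powc 1 G) (TM G) setT (@composable R n m Gr 1)
      (fun g _ => g) (fun g => (g ord0, cochain_of_vf X g)) (atlas_center aG)
      (fun g _ => @composable1 (fun=> g)) sd sX.
    by apply: smooth_along_eq.
  have := pX (fun=> g) (fun=> h) (composable1 _) (composable1 _) gh.
  by apply; apply/funext => -[].
split.
- by move=> g ncg; case: ncg; exact: composable1.
- exact: smooth_along_vf (@smooth_first R n m Gr 0) sX.
- by move=> g h _ _ gh _; exact: pX.
Qed.

Lemma smooth_delta_vf (X : G -> TG) :
  is_def_cochain (cochain_of_vf X : cochain Gr 0) ->
  @smooth_along R (powc 2 G) G (@composable R n m Gr 2) (fun g => g ord0)
    (delta (cochain_of_vf X)).
Proof.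
move=> /def_cochain_vf[sX pX]; pose W := @composable R n m Gr 2.
have s0 : @smooth_on R (powc 2 G) G W (fun g => g ord0) :=
  @smooth_first R n m Gr 1.
have s1 : @smooth_on R (powc 2 G) G W (fun g => gtail g ord0).
  exact: smooth_sub (@smooth_coord R 2 n G (lift ord0 ord0)).
have W01 z : W z -> s (z ord0) = t (gtail z ord0) by exact: composable_head.
have s01 := smooth_mul s0 s1 W01.
have Wmul z : W z -> s (mul (z ord0) (gtail z ord0)) = s (gtail z ord0).
  by move=> Wz; rewrite src_mul//; exact: W01.
have sm := smooth_along_dmbar (@powc_center 2) (smooth_along_vf s01 sX)
  (smooth_along_vf s1 sX) Wmul (fun z Wz => pX _ _ (Wmul z Wz)).
have sm' : @smooth_along R (powc 2 G) G W (fun g => g ord0)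
    (fun z => dmbar (mul (z ord0) (gtail z ord0)) (gtail z ord0)
      (X (mul (z ord0) (gtail z ord0))) (X (gtail z ord0))).
  by apply: smooth_along_eq sm => [z Wz|//]; rewrite gmulK//; exact: W01.
have := smooth_along_lin (-1) sm' (smooth_along_vf s0 sX).
by apply: smooth_along_eq => [//|z Wz]; rewrite delta_vf// scaleN1r addrC.
Qed.

(** * The embedding u -> c_u of the isotropy cochains *)

Section Cu.
Variable k : nat.
Implicit Types (u v c : cochain Gr k).

Lemma ds_cu u (g : 'I_k.+1 -> G) : isotropy (t (g ord0)) (u g) ->
  ds (g ord0) (cu u g) = 0.
Proof.
by move=> [du _]; have := ds_rtr (src_unit (t (g ord0))) du; rewrite gmul1l.
Qed.

Lemma dt_cu u (g : 'I_k.+1 -> G) : isotropy (t (g ord0)) (u g) ->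
  dt (g ord0) (cu u g) = 0.
Proof.
move=> [du dtu]; have := dt_rtr (src_unit (t (g ord0))) du.
by rewrite gmul1l dtu.
Qed.

Lemma def_cochain_cu u : is_iso_cochain u -> is_def_cochain (cu u).
Proof.
move=> [zu su iu]; split.
- by move=> g ncg; rewrite /cu zu// rtr0.
- have st (z : 'I_k.+1 -> G) : composable z -> s (one (t (z ord0))) = t (z ord0).
    by move=> _; rewrite src_unit.
  have := smooth_along_rtr (@powc_center k.+1) su (@smooth_first R n m Gr k) st
    (fun z cz => (iu z cz).1).
  by apply: smooth_along_eq => [z _|//]; rewrite gmul1l.
- by move=> g h cg ch _ _; rewrite !ds_cu//; exact: iu.
Qed.

(** Right translation by the inverse of g_1 recovers the cochain. The hypotheses are pointwise, so
    that [delta_iso u] and [delta_iso_0 a] can be inserted directly. *)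
Lemma cu_inj u v : zero_ext u -> zero_ext v ->
  (forall g, composable g -> isotropy (t (g ord0)) (u g)) ->
  (forall g, composable g -> isotropy (t (g ord0)) (v g)) ->
  cu u = cu v -> u = v.
Proof.
move=> zu zv iu iv uv; apply/funext => g.
have [cg|ncg] := pselect (composable g); last by rewrite zu// zv.
rewrite -(rtrK (iu g cg).1) -(rtrK (iv g cg).1).
by congr rtr; exact: (congr1 (fun c => c g) uv).
Qed.

(** The preimage is [c] translated back to the units by the inverse of g_1; smoothness comes from
    letting the translating arrow vary with the string. *)
Lemma iso_cochain_of_def c : zero_ext c ->
  @smooth_along R (powc k.+1 G) G (@composable R n m Gr k.+1)
    (fun g => g ord0) c ->
  (forall g, composable g -> ds (g ord0) (c g) = 0 /\ dt (g ord0) (c g) = 0) ->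
  exists2 u, is_iso_cochain u & cu u = c.
Proof.
move=> zc sc dc; exists (fun g => rtr (inv (g ord0)) (g ord0) (c g)).
  split.
  - by move=> g ncg; rewrite zc// rtr0.
  - have si : @smooth_on R (powc k.+1 G) G (@composable R n m Gr k.+1)
        (fun g => inv (g ord0)).
      exact: (@smooth_comp R (powc k.+1 G) G G _ setT (fun g => g ord0) inv
        (@powc_center k.+1) (fun _ _ => I) (@smooth_first R n m Gr k)
        (@ginv_smooth R n m Gr)).
    have st (z : 'I_k.+1 -> G) : composable z -> s (z ord0) = t (inv (z ord0)).
      by move=> _; rewrite tgt_inv.
    have := smooth_along_rtr (@powc_center k.+1) sc si st (fun z cz => (dc z cz).1).
    by apply: smooth_along_eq => [z _|//]; rewrite gmulV.
  - move=> g cg; have [dsc dtc] := dc g cg; split; first exact: ds_rtrV.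
    by rewrite dt_rtrV.
apply/funext => g; rewrite /cu.
have [cg|ncg] := pselect (composable g); last by rewrite zc// !rtr0.
by rewrite rtrVK//; have [] := dc g cg.
Qed.

Lemma isotropy_lin x (r : R) (a b : TG) : isotropy x a -> isotropy x b ->
  isotropy x (r *: a + b).
Proof.
by move=> [a1 a2] [b1 b2]; split; rewrite ?ds_linear ?dt_linear ?a1 ?a2 ?b1 ?b2
  scaler0 addr0.
Qed.

Lemma isotropy0 x : isotropy (Gr := Gr) x 0.
Proof. by split; [exact: ds0|exact: dt0]. Qed.

Lemma isotropyD x (a b : TG) : isotropy x a -> isotropy x b ->
  isotropy x (a + b).
Proof. by move=> ia ib; have := isotropy_lin 1 ia ib; rewrite scale1r. Qed.

Lemma isotropyZ x (r : R) (a : TG) : isotropy x a -> isotropy x (r *: a).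
Proof. by move=> ia; have := isotropy_lin r ia (isotropy0 x); rewrite addr0. Qed.

Lemma isotropy_merge u i (g : 'I_k.+2 -> G) : is_iso_cochain u -> composable g ->
  isotropy (t (g ord0)) (u (gmerge i g)).
Proof.
move=> [_ _ iu] cg.
have ci : composable (gmerge i g) by exact: composable_merge.
have := iu _ ci; clear ci.
case: i => [|i]; last by rewrite gmergeS0.
by rewrite gmerge0 tgt_mul//; exact: composable_head.
Qed.

Lemma isotropy_tail u (g : 'I_k.+2 -> G) : is_iso_cochain u -> composable g ->
  isotropy (s (g ord0)) (u (gtail g)).
Proof.
move=> [_ _ iu] cg; have := iu _ (composable_tail cg).
by rewrite (composable_head cg).
Qed.

Lemma isotropy_init u (g : 'I_k.+2 -> G) : is_iso_cochain u -> composable g ->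
  isotropy (t (g ord0)) (u (ginit g)).
Proof.
move=> [_ _ iu] cg; have := iu _ (composable_init cg).
by rewrite ginit0.
Qed.

Lemma delta_iso_isotropy u (g : 'I_k.+2 -> G) : is_iso_cochain u ->
  composable g -> isotropy (t (g ord0)) (delta_iso u g).
Proof.
move=> iu cg; rewrite /delta_iso asboolT//.
apply: isotropyD; last exact/isotropyZ/isotropy_init.
apply: isotropyD; first exact/isotropy_Ad/isotropy_tail.
apply: (big_ind (isotropy (t (g ord0)))) => [|a b|i _]; first exact: isotropy0.
- exact: isotropyD.
- exact/isotropyZ/isotropy_merge.
Qed.

Lemma rtrZ (g h : G) (r : R) (v : TG) : rtr g h (r *: v) = r *: rtr g h v.
Proof. by rewrite -[_ *: v]addr0 rtr_linear rtr0 addr0. Qed.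

Lemma rtrD (g h : G) (v w : TG) : rtr g h (v + w) = rtr g h v + rtr g h w.
Proof. by rewrite -[v]scale1r rtr_linear !scale1r. Qed.

(** [dmbar_isotropy] turns the division term into the action term and the face g_1 g_2. All other
    faces keep g_1 as first arrow, so the same linear map r_{g_1} is applied to each. *)
Lemma delta_cu u : is_iso_cochain u -> delta (cu u) = cu (delta_iso u).
Proof.
move=> iu; apply/funext => g; rewrite /cu /delta /delta_iso.
have [cg|ncg] := pselect (composable g); last by rewrite !asboolF// rtr0.
have gh := composable_head cg; rewrite !asboolT//.
have it : isotropy (t (gtail g ord0)) (u (gtail g)).
  by rewrite -gh; exact: isotropy_tail.
rewrite gmerge0 (dmbar_isotropy gh (isotropy_merge 0 iu cg) it) ginit0.
rewrite 2!rtrD rtrZ; congr (_ + _).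
(* The face of index 0 leaves the sum: in [delta] it is part of the division term and the sum starts
   at 1. *)
rewrite [in RHS]big_ltn// expr1 rtrD scaleN1r.
have rN (h h' : G) (v : TG) : rtr h h' (- v) = - rtr h h' v.
  by rewrite -scaleN1r rtrZ scaleN1r.
rewrite rN opprB addrA; congr (_ + _).
rewrite (big_morph (rtr (g ord0) (one (t (g ord0)))) (rtrD _ _) (rtr0 _ _)).
apply: eq_big_nat => -[//|i] _.
by rewrite rtrZ gmergeS0.
Qed.

End Cu.

(** * Lifts of base fields and their coboundaries *)

Lemma dmbarB (p q : G) (v w v' w' : TG) :
  dmbar p q (v - v') (w - w') = dmbar p q v w - dmbar p q v' w'.
Proof.
apply/eqP; rewrite eq_sym subr_eq; apply/eqP.
by rewrite -dmbarD !subrK.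
Qed.

(** The source of p q^-1 is the target of q, which is why the target projection of [X] appears in a
    source projection. *)
Lemma ds_delta_vf (X : G -> TG) (g : 'I_2 -> G) : composable g ->
  (forall g h : G, s g = s h -> ds g (X g) = ds h (X h)) ->
  ds (g ord0) (delta (cochain_of_vf X) g) =
  ds (g ord0) (X (g ord0)) - dt (gtail g ord0) (X (gtail g ord0)).
Proof.
move=> cg pX; have gh := composable_head cg.
rewrite delta_vf// dsD dsN; congr (_ - _).
rewrite -[X in ds X (dmbar _ _ _ _)](gmulK gh).
by apply: ds_dmbar; [exact: src_mul|apply: pX; exact: src_mul].
Qed.

Lemma dt_delta_vf (X : G -> TG) (g : 'I_2 -> G) : composable g ->
  (forall g h : G, s g = s h -> ds g (X g) = ds h (X h)) ->
  dt (g ord0) (delta (cochain_of_vf X) g) = dt (g ord0) (X (g ord0)) -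
  dt (mul (g ord0) (gtail g ord0)) (X (mul (g ord0) (gtail g ord0))).
Proof.
move=> cg pX; have gh := composable_head cg.
rewrite delta_vf// dtD dtN; congr (_ - _).
rewrite -[X in dt X (dmbar _ _ _ _)](gmulK gh).
by apply: dt_dmbar; [exact: src_mul|apply: pX; exact: src_mul].
Qed.

Lemma lift_projectable V (X : G -> TG) : is_lift V X ->
  forall g h : G, s g = s h -> ds g (X g) = ds h (X h).
Proof. by move=> [_ _ dsX _] g h gh; rewrite !dsX gh. Qed.

Lemma lift_def_cochain V (X : G -> TG) : is_lift V X ->
  is_def_cochain (cochain_of_vf X : cochain Gr 0).
Proof.
move=> lX; apply/def_cochain_vf; split; last exact: lift_projectable lX.
by have [] := lX.
Qed.

Lemma delta_delta_lift V (X : G -> TG) : is_lift V X ->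
  delta (delta (cochain_of_vf X)) = 0.
Proof.
move=> /lift_projectable pX; apply/funext => g.
have [cg|ncg] := pselect (composable g); last by rewrite /delta asboolF.
have c0 : composable (gmerge 0 g) by exact: composable_merge.
have c1 : composable (gmerge 1 g) by exact: composable_merge.
have ct := composable_tail cg; have ci := composable_init cg.
rewrite [LHS]/delta asboolT// big_nat1 !delta_vf// !gmerge0 !gmergeS0 !ginit0.
have m0 : gtail (gmerge 0 g) ord0 = gtail (gtail g) ord0 by [].
have i1 : gtail (ginit g) ord0 = gtail g ord0 by congr g; exact: val_inj.
have m1 : gtail (gmerge 1 g) ord0 = mul (gtail g ord0) (gtail (gtail g) ord0).
  by rewrite -i1.
rewrite m0 m1 i1; have ab := composable_head cg; have bc := composable_head ct.
move: (g ord0) (gtail g ord0) (gtail (gtail g) ord0) ab bc => a b c ab bc.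
have abc : s (mul a b) = t c by rewrite src_mul.
rewrite dmbarB (gmulA ab bc).
have src3 : s (mul (mul a b) c) = s c by rewrite src_mul.
have src2 : s (mul b c) = s c by rewrite src_mul.
have src32 : s (mul (mul a b) c) = s (mul b c) by rewrite src3.
(* The nested division term, with common divisor c, collapses to the division of the field at abc by
   the field at bc, which the face (a, bc) cancels; the other terms cancel in pairs. *)
have := dmbar_dmbar src32 src3 (pX _ _ src32) (pX _ _ src3).
rewrite (gmulK abc) (gmulK bc) => ->.
rewrite sqrrN expr1n scale1r exprS sqrrN expr1n mulr1 scaleN1r.
set x := dmbar (mul a b) b _ _; set y := dmbar _ (mul b c) _ _; set z := X a.
by rewrite !opprB [y - x + _]addrC [z - y + (y - x)]addrA subrK addrA subrK subrr.
Qed.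

Lemma delta_iso_zero_ext k (u : cochain Gr k) : zero_ext (delta_iso u).
Proof. by move=> g ncg; rewrite /delta_iso asboolF. Qed.

Lemma delta_iso_eq k (u : cochain Gr k) (v : cochain Gr k.+1) :
  is_iso_cochain u -> is_iso_cochain v -> cu v = delta (cu u) -> v = delta_iso u.
Proof.
move=> iu [zv _ iv] E; apply: cu_inj => //; first exact: delta_iso_zero_ext.
  by move=> g; exact: delta_iso_isotropy.
by rewrite -delta_cu.
Qed.

Lemma delta_cu_eq0 k (u : cochain Gr k) : is_iso_cochain u ->
  delta (cu u) = 0 <-> delta_iso u = 0.
Proof.
move=> iu; have [z0 _ i0] := @iso_cochain0 R n m Gr k.+1.
have cu0 : cu (0 : cochain Gr k.+1) = 0 by apply/funext => g; exact: rtr0.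
split=> [du|]; last by rewrite delta_cu// => ->.
by apply/esym/(delta_iso_eq iu); [exact: iso_cochain0|rewrite du].
Qed.

Lemma iso_def_cocycle k (u : cochain Gr k) : is_iso_cochain u ->
  is_iso_cocycle u <-> is_def_cocycle (cu u).
Proof.
move=> iu; split=> [[_ du]|[_ du]].
  by split; [exact: def_cochain_cu|apply/delta_cu_eq0].
split; [exact: iu|exact: (delta_cu_eq0 iu).1].
Qed.

(** At (g, h) the two projections of delta X are V (s g) - V (t h) and V (t g) - V (t (g h)), both
    zero. The resulting [v] represents the image of V under K. *)
Lemma lift_cocycle V (X : G -> TG) : is_lift V X ->
  exists2 v : cochain Gr 1, is_iso_cocycle v & cu v = delta (cochain_of_vf X).
Proof.
move=> lX; have pX := lift_projectable lX; have [_ _ dsX dtX] := lX.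
have zX : zero_ext (delta (cochain_of_vf X)).
  by move=> g ncg; rewrite /delta asboolF.
have dX (g : 'I_2 -> G) : composable g ->
    ds (g ord0) (delta (cochain_of_vf X) g) = 0 /\
    dt (g ord0) (delta (cochain_of_vf X) g) = 0.
  move=> cg; have gh := composable_head cg; split.
    by rewrite ds_delta_vf// dsX dtX gh subrr.
  by rewrite dt_delta_vf// !dtX tgt_mul// subrr.
have [v iv vE] := iso_cochain_of_def zX (smooth_delta_vf (lift_def_cochain lX)) dX.
exists v => //; split=> //.
by apply/(delta_cu_eq0 iv); rewrite vE (delta_delta_lift lX).
Qed.

Lemma lift_unique V W (X : G -> TG) : is_lift V X -> is_lift W X -> V = W.
Proof.
move=> [_ _ dsV _] [_ _ dsW _]; apply/funext => x.
by rewrite -(src_unit (l := Gr) x) -dsV dsW.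
Qed.

Lemma lift_lin (r : R) V W (X Y : G -> TG) : is_lift V X -> is_lift W Y ->
  is_lift (r *: V + W) (r *: X + Y).
Proof.
move=> [sV sX dsX dtX] [sW sY dsY dtY]; split=> [||g|g].
- exact: (smooth_along_lin r sV sW).
- exact: (smooth_along_lin r sX sY).
- by rewrite -[(_ + Y) _]/(r *: X g + Y g) ds_linear dsX dsY.
- by rewrite -[(_ + Y) _]/(r *: X g + Y g) dt_linear dtX dtY.
Qed.

Lemma liftB V W (X Y : G -> TG) : is_lift V X -> is_lift W Y ->
  is_lift (V - W) (X - Y).
Proof.
move=> lX lY; have := lift_lin (-1) lY lX.
by rewrite !scaleN1r addrC [_ + X]addrC.
Qed.

(** With its converse [cu_lift0], this identifies the lifts of the zero field with the isotropy
    1-cochains: the ambiguity in the choice of a lift. *)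
Lemma lift0_cu (X : G -> TG) : is_lift 0 X ->
  exists2 u : cochain Gr 0, is_iso_cochain u & cu u = cochain_of_vf X.
Proof.
move=> lX; have [zX sX _] := lift_def_cochain lX; have [_ _ dsX dtX] := lX.
have dX (g : 'I_1 -> G) : composable g ->
    ds (g ord0) (cochain_of_vf X g) = 0 /\ dt (g ord0) (cochain_of_vf X g) = 0.
  by move=> _; split; [exact: dsX|exact: dtX].
exact: iso_cochain_of_def zX sX dX.
Qed.

Lemma cu_lift0 (u : cochain Gr 0) : is_iso_cochain u ->
  is_lift 0 (fun g => cu u (fun=> g)).
Proof.
move=> iu; have [_ _ uu] := iu; have cc g := @composable1 (fun=> g).
have duu := def_cochain_cu iu; rewrite (cochain0E (cu u)) in duu.
have [sX _] := (def_cochain_vf _).1 duu.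
split; [|exact: sX|move=> g|move=> g].
- exact/smooth_along0/smooth_id.
- by rewrite (ds_cu (uu _ (cc g))).
- by rewrite (dt_cu (uu _ (cc g))).
Qed.

(** Stated for delta X in ker ds rather than delta X = 0, so as to serve both for 1-cocycles and for
    fields whose coboundary is some c_v. *)
Lemma lift_of_delta (X : G -> TG) :
  is_def_cochain (cochain_of_vf X : cochain Gr 0) ->
  (forall g : 'I_2 -> G, composable g ->
    ds (g ord0) (delta (cochain_of_vf X) g) = 0) ->
  exists V, is_lift V X.
Proof.
move=> /def_cochain_vf[sX pX] dX; pose V x := ds (one x) (X (one x)).
have dsX g : ds g (X g) = V (s g) by apply: pX; rewrite src_unit.
exists V; split; [|exact: sX|exact: dsX|move=> g].
  have sXu : @smooth_along R M G setT one (X \o one).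
    exact: (@smooth_comp R M G (TM G) setT setT one (fun g => (g, X g))
      (atlas_center aM) (fun _ _ => I) (@unit_smooth R n m Gr) sX).
  have := smooth_along_tmap (atlas_center aM) aG aM (src_submersion Gr).1 sXu.
  by apply: smooth_along_eq => [x _|//]; exact: src_unit.
(* On the pair (1_{t g}, g) the source projection of delta X is V (t g) - dt X(g). *)
have c1 : composable (pair_string (one (t g)) g).
  by apply: composable_pair; rewrite src_unit.
have E : ds (one (t g)) (X (one (t g))) - dt g (X g) = 0 :=
  etrans (esym (ds_delta_vf c1 pX)) (dX _ c1).
by move/subr0_eq: E; rewrite dsX src_unit => <-.
Qed.

Lemma cocycle_lift (X : G -> TG) :
  is_def_cocycle (cochain_of_vf X : cochain Gr 0) ->
  exists V, is_lift V X.
Proof.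
move=> [cX dX]; apply: lift_of_delta => // g cg.
by rewrite dX; exact: ds0.
Qed.

Lemma cu_linear k : linear (@cu R n m Gr k).
Proof. by move=> r u v; apply/funext => g; exact: rtr_linear. Qed.

Lemma cuB k (u v : cochain Gr k) : cu (u - v) = cu u - cu v.
Proof. by rewrite addrC -scaleN1r cu_linear scaleN1r addrC. Qed.

(** On the isotropy [di] is -1, so [delta_0 a] is r_g a - l_g a, while [delta_iso_0 a] translates to
    l_g a - r_g a. *)
Lemma cu_delta_iso_0 a : is_iso_section a -> cu (delta_iso_0 a) = - delta_0 a.
Proof.
move=> [[sa dsa] ra]; apply/funext => g.
have ia x : isotropy x (a x) by split; [exact: dsa|exact: ra].
rewrite /cu /delta_iso_0 -[- a _]scaleN1r rtrD rtrZ scaleN1r rtr_Ad//.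
rewrite -[RHS]/(- (rarrow a (g ord0) + larrow a (g ord0))) opprD addrC.
by rewrite /larrow di_isotropy// ltrN opprK.
Qed.

Lemma delta_iso_0_isotropy a (g : 'I_1 -> G) : is_iso_section a ->
  isotropy (t (g ord0)) (delta_iso_0 a g).
Proof.
move=> [[sa dsa] ra]; have ia x : isotropy x (a x).
  by split; [exact: dsa|exact: ra].
rewrite /delta_iso_0 -[- a _]scaleN1r.
by apply: isotropyD; [exact: isotropy_Ad|exact: isotropyZ].
Qed.

(** The same field lifts [rho a], being [delta_0 a], and 0, being c_u; a field lifts at most one
    base field. This is the injectivity of r in degree one. *)
Lemma delta_0_anchor0 a (u : cochain Gr 0) : is_section a -> is_iso_cochain u ->
  cu u = delta_0 a -> is_iso_section a.
Proof.
move=> sa iu ua; split=> // x.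
have l0 := cu_lift0 iu; rewrite ua in l0.
by have := congr1 (fun V => V x) (lift_unique (lift_arrows_vf sa) l0).
Qed.

End Cochains.

(** * The exact sequence *)

Section ExactSequence.
Variables (R : realType) (n m : nat) (Gr : lie_groupoid R n m).
Local Notation G := (arr Gr).
Local Notation M := (obj Gr).

Lemma cu_coboundary k (u : cochain Gr k) :
  is_iso_coboundary u -> is_def_coboundary (cu u).
Proof.
case: k u => [|k] u /=.
  (* The section -a, in the shape expected by [section_lin]; the sign is that of
     [cu_delta_iso_0]. *)
  move=> [a ia ->]; exists (-1 *: a + 0).
    by apply: section_lin; [have [] := ia|exact: section0].
  rewrite delta_0_linear (linear_0 (@delta_0_linear _ _ _ Gr)) addr0 scaleN1r.
  exact: cu_delta_iso_0.
move=> [b ib ->]; exists (cu b); first exact: def_cochain_cu.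
by rewrite delta_cu.
Qed.

Lemma cu_coboundary0 (u : cochain Gr 0) : is_iso_cochain u ->
  is_def_coboundary (cu u) -> is_iso_coboundary u.
Proof.
move=> iu [a sa ua]; have ia := delta_0_anchor0 sa iu ua.
have ia' : is_iso_section (-1 *: a + 0).
  by apply: iso_section_lin => //; exact: iso_section0.
exists (-1 *: a + 0) => //; have [zu _ isou] := iu.
apply: cu_inj => //.
- by move=> g ncg; case: ncg; exact: composable1.
- by move=> g _; exact: delta_iso_0_isotropy.
- rewrite ua cu_delta_iso_0// delta_0_linear.
  by rewrite (linear_0 (@delta_0_linear _ _ _ Gr)) addr0 scaleN1r opprK.
Qed.

Lemma r_exists k : exists r : {linear H_iso Gr k -> H_def Gr k},
  forall u, is_iso_cocycle u -> r (cls u) = cls (cu u).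
Proof.
have rlin (a : R) (z w z' w' : cochain Gr k) : z' = cu z -> w' = cu w ->
    a *: z' + w' = cu (a *: z + w).
  by move=> -> ->; rewrite cu_linear.
have rtot (u : cochain Gr k) : iso_cocycles Gr k u ->
    exists2 c, def_cocycles Gr k c & c = cu u.
  by move=> cu_u; exists (cu u); [exact: (iso_def_cocycle cu_u.1).1|].
have rB (u c : cochain Gr k) : iso_cocycles Gr k u -> def_cocycles Gr k c ->
    c = cu u -> iso_coboundaries Gr k u -> def_coboundaries Gr k c.
  by move=> _ _ ->; exact: cu_coboundary.
have [r rE] := induced_linear_map rlin rtot rB.
exists r => u cu_u; apply: rE => //.
exact: (iso_def_cocycle cu_u.1).1.
Qed.

Lemma pi_exists : exists pi : {linear H_def Gr 0 -> normal_inv Gr},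
  forall (X : G -> 'rV[R]_n) V, is_def_cocycle (cochain_of_vf X : cochain Gr 0) ->
    is_lift V X -> pi (cls (cochain_of_vf X)) = cls V.
Proof.
pose rel (c : cochain Gr 0) (V : M -> 'rV[R]_m) := is_lift V (fun g => c (fun=> g)).
have rlin (a : R) z w z' w' : rel z z' -> rel w w' ->
  rel (a *: z + w) (a *: z' + w') by exact: lift_lin.
have rtot c : def_cocycles Gr 0 c -> exists2 V, liftable_fields Gr V & rel c V.
  move=> cc; rewrite (cochain0E c) in cc; have [V lV] := cocycle_lift cc.
  by exists V => //; exists (fun g => c (fun=> g)).
have rB c V : def_cocycles Gr 0 c -> liftable_fields Gr V -> rel c V ->
    def_coboundaries Gr 0 c -> anchored_fields Gr V.
  move=> _ _ lV [a sa ca]; exists a => //.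
  rewrite /rel ca in lV; exact: lift_unique lV (lift_arrows_vf sa).
have [pi piE] := induced_linear_map rlin rtot rB.
exists pi => X V cX lV; apply: piE => //; by exists X.
Qed.

(** X and delta a lift the same field, so their difference lifts 0. This shows both that K vanishes
    on anchored fields and that the kernel of pi lies in the image of r. *)
Lemma lift_anchored_cocycle (a : M -> 'rV[R]_n) (X : G -> 'rV[R]_n) :
  is_section a -> is_lift (rho a) X ->
  exists2 u : cochain Gr 0, is_iso_cochain u & cu u = cochain_of_vf X - delta_0 a.
Proof.
move=> sa lX; have := liftB lX (lift_arrows_vf sa); rewrite subrr => l0.
by have [u iu uE] := lift0_cu l0; exists u.
Qed.

Lemma deltaB k (c d : cochain Gr k) : delta (c - d) = delta c - delta d.
Proof. by rewrite addrC -scaleN1r delta_linear scaleN1r addrC. Qed.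

Lemma K_exists : exists K : {linear normal_inv Gr -> H_iso Gr 1},
  forall (X : G -> 'rV[R]_n) V (v : cochain Gr 1),
    is_lift V X -> is_iso_cocycle v -> cu v = delta (cochain_of_vf X) -> K (cls V) = cls v.
Proof.
(* The lift stays existential: related cocycles may come from different lifts of V, and their
   difference is handled by the case of an anchored field, namely 0. *)
pose rel (V : M -> 'rV[R]_m) (v : cochain Gr 1) :=
  exists2 X : G -> 'rV[R]_n, is_lift V X & cu v = delta (cochain_of_vf X).
have rlin (a : R) z w z' w' : rel z z' -> rel w w' ->
    rel (a *: z + w) (a *: z' + w').
  move=> [X lX vX] [Y lY vY]; exists (a *: X + Y); first exact: lift_lin.
  by rewrite cu_linear vX vY -delta_linear.
have rtot V : liftable_fields Gr V -> exists2 v, iso_cocycles Gr 1 v & rel V v.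
  move=> [X lX]; have [v cv vX] := lift_cocycle lX.
  by exists v => //; exists X.
have rB V v : liftable_fields Gr V -> iso_cocycles Gr 1 v -> rel V v ->
    anchored_fields Gr V -> iso_coboundaries Gr 1 v.
  move=> _ [iv _] [X lX vX] [a sa Va]; rewrite Va in lX.
  have [u iu uX] := lift_anchored_cocycle sa lX.
  exists u => //; apply: delta_iso_eq => //.
  by rewrite uX deltaB delta_delta_0// subr0.
have [K KE] := induced_linear_map rlin rtot rB.
exists K => X V v lX cv vX; apply: KE => //; by exists X.
Qed.

End ExactSequence.

Theorem proposition4p11 (R : realType) (n m : nat) (Gr : lie_groupoid R n m) :
  exists (r1 : {linear H_iso Gr 0 -> H_def Gr 0})
         (pi : {linear H_def Gr 0 -> normal_inv Gr})
         (K : {linear normal_inv Gr -> H_iso Gr 1})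
         (r2 : {linear H_iso Gr 1 -> H_def Gr 1}),
    [/\ is_r r1, is_pi pi, is_K K & is_r r2] /\
    [/\ injective r1, exact_at r1 pi, exact_at pi K & exact_at K r2].
Proof.
have [r1 r1E] := r_exists Gr 0; have [pi piE] := pi_exists Gr.
have [K KE] := K_exists Gr; have [r2 r2E] := r_exists Gr 1.
exists r1, pi, K, r2; split.
  split.
  - move=> u cu_u; split; [exact: (iso_def_cocycle cu_u.1).1|exact: r1E].
  - by move=> X cX; split=> [|V lV]; [exact: cocycle_lift|exact: piE].
  - move=> V X lX; have [v cv vX] := lift_cocycle lX; exists v.
    split=> // [w cw wX|]; last exact: KE lX cv vX.
    have [[zv _ iv] _] := cv; have [[zw _ iw] _] := cw.
    by apply: cu_inj => //; rewrite wX.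
  - move=> u cu_u; split; [exact: (iso_def_cocycle cu_u.1).1|exact: r2E].
have cocycle_lin k (u v : cochain Gr k) : is_iso_cocycle u -> is_iso_cocycle v ->
    is_iso_cocycle (u - v).
  by move=> cu_u cu_v; rewrite addrC -scaleN1r; exact: iso_cocycle_lin.
split.
- move=> p q; have [u cu_u ->] := clsP p; have [v cu_v ->] := clsP q.
  rewrite !r1E// => /cls_eq E.
  have B := E ((iso_def_cocycle cu_u.1).1 cu_u) ((iso_def_cocycle cu_v.1).1 cu_v).
  apply/cls_eq => //; rewrite -cuB in B.
  by apply: cu_coboundary0 => //; have [] := cocycle_lin _ _ _ cu_u cu_v.
- move=> y; split.
    move=> [x <-]; have [u cu_u ->] := clsP x; rewrite r1E//.
    have cc := (iso_def_cocycle cu_u.1).1 cu_u; rewrite (cochain0E (cu u)) in cc *.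
    rewrite (piE _ _ cc (cu_lift0 cu_u.1)).
    by apply/cls_eq0; [exact: liftable0|exact: anchored0].
  have [c cc ->] := clsP y; rewrite (cochain0E c) in cc *.
  move: (fun g => c (fun=> g)) cc => X cX.
  have [V lV] := cocycle_lift cX; rewrite (piE _ _ cX lV).
  have LV : liftable_fields Gr V by exists X.
  (* If [V] vanishes then V = rho a, and X is cohomologous to X - delta a, which is c_u for a
     cocycle [u]. *)
  move=> /(cls_eq0 _ LV)[a sa Va]; rewrite Va in lV.
  have [u iu uX] := lift_anchored_cocycle sa lV.
  have cu_u : is_iso_cocycle u.
    split=> //; apply/(delta_cu_eq0 iu).
    by rewrite uX deltaB delta_delta_0// subr0; case: cX.
  exists (cls u); rewrite r1E//; apply/cls_eq => //.
    exact: (iso_def_cocycle iu).1 cu_u.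
  rewrite uX addrAC subrr add0r -scaleN1r -[_ *: _]addr0.
  by apply: def_coboundary_lin; [exists a|exact: def_coboundary0].
- move=> y; split.
    move=> [x <-]; have [c cc ->] := clsP x; rewrite (cochain0E c) in cc *.
    move: (fun g => c (fun=> g)) cc => X cX.
    have [V lV] := cocycle_lift cX; rewrite (piE _ _ cX lV).
    (* A multiplicative field is itself a lift of V, and delta X = 0 = c_0, so the cocycle attached
       to it is 0. *)
    rewrite (KE X V 0 lV); last 2 first.
    - exact: iso_cocycle0.
    - by rewrite (linear_0 (@cu_linear _ _ _ Gr 1)); case: cX.
    by apply/cls_eq0; [exact: iso_cocycle0|exact: iso_coboundary0].
  have [V [X lX] ->] := clsP y; have [v cv vX] := lift_cocycle lX.
  have Zv : iso_cocycles Gr 1 v := cv.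
  rewrite (KE _ _ _ lX cv vX) => /(cls_eq0 _ Zv)[u iu vu].
  (* As v = delta u, the lift is corrected by c_u, which lifts 0: X - c_u still lifts V, and its
     coboundary is c_v - c_{delta u} = 0. *)
  have lX' := liftB lX (cu_lift0 iu); rewrite subr0 in lX'.
  have E : cochain_of_vf (X - (fun g => cu u (fun=> g))) =
      cochain_of_vf X - cu u.
    by rewrite [in RHS](cochain0E (cu u)).
  have cX' : is_def_cocycle
      (cochain_of_vf (X - (fun g => cu u (fun=> g))) : cochain Gr 0).
    split; first exact: lift_def_cochain lX'.
    by rewrite E deltaB -vX vu delta_cu// subrr.
  by exists (cls (cochain_of_vf (X - (fun g => cu u (fun=> g)))));
    rewrite (piE _ _ cX' lX').
- move=> y; split.
    move=> [x <-]; have [V [X lX] ->] := clsP x; have [v cv vX] := lift_cocycle lX.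
    rewrite (KE _ _ _ lX cv vX) r2E//; apply/cls_eq0.
      exact: (iso_def_cocycle cv.1).1 cv.
    by exists (cochain_of_vf X) => //; exact: lift_def_cochain lX.
  have [v cv ->] := clsP y; rewrite r2E//.
  have Zv : def_cocycles Gr 1 (cu v) := (iso_def_cocycle cv.1).1 cv.
  move=> /(cls_eq0 _ Zv)[b db vb].
  rewrite (cochain0E b) in db vb; move: (fun g => b (fun=> g)) db vb => X dX vX.
  (* The equation delta X = c_v puts delta X in ker ds, so X is an (s,t)-lift of some V, and then
     [v] is the cocycle that defines K [V]. *)
  have [V lV] : exists V, is_lift V X.
    apply: lift_of_delta => // g cg; rewrite -vX; apply: ds_cu.
    by have [[_ _ iv] _] := cv; exact: iv.
  by exists (cls V); exact: KE lV cv vX.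
Qed.
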